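(* Suppose $A$ is a $(\mathcal C,\alpha)$-graded algebra and $M$ is a $(\mathcal C,\alpha)$-graded $(A,A)$-bimodule. Assume furthermore that the grading category $(\mathcal C,\alpha)$ admits a looper $\varepsilon$. Then, fixing the choice of the triple $(\mathcal C,\alpha,\varepsilon)$, there is a $(\mathcal C,\alpha,\varepsilon)$-Hochschild homology of $A$ with coefficients in $M$, denoted $\mathsf{HH}^{(\mathcal C,\alpha,\varepsilon)}_\bullet(A,M)$, extending classical Hochschild homology. That is, if $A$ is an associative, $G$-graded algebra for some group $G$, then $$\mathsf{HH}^{(BG,1,1)}_\bullet(A,M)\cong\mathsf{HH}_\bullet(A,M).$$
   Context: Let $\Bbbk$ be a commutative unital ring with unit group $\Bbbk^\times$ and $\mathcal C$ a small category. A grading category is a pair $(\mathcal C,\alpha)$ where $\alpha$ assigns to each composable triple $(f_1,f_2,f_3)$ (so $f_3\circ f_2\circ f_1$ is defined) an element of $\Bbbk^\times$ such that for all composable $(f_1,f_2,f_3,f_4)$: $\alpha(f_1,f_2,f_3)\,\alpha(f_1,f_2,f_4\circ f_3)^{-1}\alpha(f_1,f_3\circ f_2,f_4)\,\alpha(f_2\circ f_1,f_3,f_4)^{-1}\alpha(f_2,f_3,f_4)=1$. For a group $G$, $BG$ is the category with one object and morphism group $G$; in $(BG,1,1)$ one takes $\alpha\equiv1$ and $\varepsilon\equiv1$, and $M$ is then a $G$-graded $(A,A)$-bimodule. A $\mathcal C$-graded module is a $\Bbbk$-module $M=\bigoplus_{g\in\mathrm{Mor}(\mathcal C)}M_g$;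 write $|x|=g$ for $x\in M_g$. Graded maps are $\Bbbk$-linear and preserve each $M_g$. The tensor product is $(M\otimes N)_g=\bigoplus_{g=g_2\circ g_1}M_{g_1}\otimes_\Bbbk N_{g_2}$ (tensors and products of elements with non-composable degrees are zero). Unitor constants: for $g:X\to Y$, $\mathcal L(\mathrm{Id}_X,g)=\alpha(\mathrm{Id}_X,\mathrm{Id}_X,g)^{-1}$ and $\mathcal R(g,\mathrm{Id}_Y)=\alpha(g,\mathrm{Id}_Y,\mathrm{Id}_Y)$. A $(\mathcal C,\alpha)$-graded algebra is a $\mathcal C$-graded module $A$ with a graded $\Bbbk$-linear $\mu:A\otimes A\to A$ (so $|\mu(x,y)|=|y|\circ|x|$) and elements $1_X\in A_{\mathrm{Id}_X}$ ($X\in\mathrm{Ob}(\mathcal C)$) with, for homogeneous elements, $\mu(\mu(x,y),z)=\alpha(|x|,|y|,|z|)\mu(x,\mu(y,z))$, $\mu(1_X,x)=\mathcal L(\mathrm{Id}_X,|x|)x$ and $\mu(x,1_Y)=\mathcal R(|x|,\mathrm{Id}_Y)x$ if $|x|:X\to Y$. A $(\mathcal C,\alpha)$-graded $(A,B)$-bimodule is a $\mathcal C$-graded module $M$ with graded $\Bbbk$-linear maps $\rho_L:A\otimes M\to M$, $\rho_R:M\otimes B\to M$ such that, for homogeneous elements, $\rho_L(\mu_A(a,a'),m)=\alpha(|a|,|a'|,|m|)\rho_L(a,\rho_L(a',m))$, $\rho_R(\rho_R(m,b),b')=\alpha(|m|,|b|,|b'|)\rho_R(m,\mu_B(b,b'))$,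 $\rho_R(\rho_L(a,m),b)=\alpha(|a|,|m|,|b|)\rho_L(a,\rho_R(m,b))$, and $\rho_L(1_X,m)=\mathcal L(\mathrm{Id}_X,|m|)m$, $\rho_R(m,1_Y)=\mathcal R(|m|,\mathrm{Id}_Y)m$ for $|m|:X\to Y$. A looper for $(\mathcal C,\alpha)$ is a function $\varepsilon$ assigning to each pair $f:X\to Y$, $g:Y\to X$ an element $\varepsilon(f,g)\in\Bbbk^\times$ with (i) $\varepsilon(f,g)^{-1}=\varepsilon(g,f)$ and (ii) for every loop $h\circ g\circ f$ of length three, $\alpha(f,g,h)\varepsilon(f,h\circ g)\,\alpha(g,h,f)\varepsilon(g,f\circ h)\,\alpha(h,f,g)\varepsilon(h,g\circ f)=1$. Meaning of $\mathsf{HH}^{(\mathcal C,\alpha,\varepsilon)}_\bullet(A,M)$: it is the homology of $M\otimes_{A\otimes_\Bbbk A^{\mathrm{op}}}\mathcal B(A)$, where the ingredients are as follows. For $(\mathcal C,\alpha)$-graded $(A,A)$-bimodules $M,N$, put $\rho^e_R(m,a\otimes a')=\rho_L(a',\rho_R(m,a))$ and $\rho_L^e(a\otimes a',n)=\rho_R(\rho_L(a,n),a')$. Then $M\otimes_{A\otimes_\Bbbk A^{\mathrm{op}}}N$ is the quotient of $M\otimes N$ by the elements $\rho_R^e(m,a\otimes a')\otimes n-\Theta\, m\otimes\rho_L^e(a\otimes a',n)$ for homogeneous $m,n,a,a'$, where, when $|m|,|a|,|n|,|a'|$ form (in this order) a loop of length four, $\Theta=\alpha(|a'|,|a|\circ|m|,|n|)\,\varepsilon(|a'|,|n|\circ|a|\circ|m|)\,\alpha(|m|,|a|,|n|)\,\alpha(|m|,|n|\circ|a|,|a'|)$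 (terms with non-composable degrees are zero). The bar construction $\mathcal B(A)$ is $A^{\otimes n+2}$ (parenthesized to the left) in homological degree $n\ge0$, with $\partial(a_0\otimes\cdots\otimes a_{n+1})=\sum_{i=0}^n(-1)^i\alpha(|a_{i-1}|\circ\cdots\circ|a_0|,|a_i|,|a_{i+1}|)\,a_0\otimes\cdots\otimes\mu(a_i,a_{i+1})\otimes\cdots\otimes a_{n+1}$ (the $\alpha$-factor for $i=0$ being $1$), and bimodule structure $\rho_L(a,a_0\otimes\cdots\otimes a_{n+1})=\prod_{i=1}^{n+1}\alpha(|a|,|a_{i-1}|\circ\cdots\circ|a_0|,|a_i|)^{-1}\,\mu(a,a_0)\otimes a_1\otimes\cdots\otimes a_{n+1}$, $\rho_R(a_0\otimes\cdots\otimes a_{n+1},a)=\alpha(|a_n|\circ\cdots\circ|a_0|,|a_{n+1}|,|a|)\,a_0\otimes\cdots\otimes a_n\otimes\mu(a_{n+1},a)$. $\mathsf{HH}_\bullet(A,M)$ without superscript is the classical Hochschild homology of the associative algebra $A$ with coefficients in $M$. *)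

(* Defs.v *)
From HB Require Import structures.
From mathcomp Require Import all_boot all_order all_algebra.
From mathcomp Require Import all_classical.
From mathcomp Require Import generic_quotient ring_quotient.

Set Implicit Arguments.
Unset Strict Implicit.
Unset Printing Implicit Defensive.
Import GRing.Theory.
Local Open Scope ring_scope.
Local Open Scope quotient_scope.

Section Lin.
Variables (K : pzRingType) (U V : lmodType K).
Definition lin_fun (f : U -> V) (_ : linear f) : U -> V := f.
Variables (f : U -> V) (fP : linear f).
HB.instance Definition _ := GRing.isLinear.Build K U V *:%R (lin_fun fP) fP.
(* Locked, so that [simpl] does not unfold the maps built below. *)
Definition lin : {linear U -> V} := locked (lin_fun fP : {linear U -> V}).
Lemma linE x : lin x = f x. Proof. by rewrite /lin; unlock. Qed.
End Lin.

(* [pres R] is the [K]-module with generators [T] and relations [s = t] for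
   [R s t], where [s] and [t] are formal linear combinations.  [{classic T}] only
   provides [T] with the equality and choice needed to form the quotient. *)
Section Presented.
Variables (K : comPzRingType) (T : Type).
Implicit Types s t : seq (K * {classic T}).

Definition fscale (a : K) s : seq (K * {classic T}) :=
  [seq (a * p.1, p.2) | p <- s].

Variable R : seq (K * {classic T}) -> seq (K * {classic T}) -> Prop.

Inductive pres_eq : seq (K * {classic T}) -> seq (K * {classic T}) -> Prop :=
| pres_refl s : pres_eq s s
| pres_sym s t : pres_eq s t -> pres_eq t s
| pres_trans s t u : pres_eq s t -> pres_eq t u -> pres_eq s u
| pres_cat s s' t t' : pres_eq s s' -> pres_eq t t' ->
    pres_eq (s ++ t) (s' ++ t')
| pres_comm s t : pres_eq (s ++ t) (t ++ s)
| pres_scale a s t : pres_eq s t -> pres_eq (fscale a s) (fscale a t)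
| pres_coefD a b x : pres_eq [:: (a + b, x)] [:: (a, x); (b, x)]
| pres_coef0 x : pres_eq [:: (0, x)] [::]
| pres_rel s t : R s t -> pres_eq s t.

Definition pres_eqb s t : bool := `[< pres_eq s t >].

Lemma pres_eqb_equiv : equiv_class_of pres_eqb.
Proof.
split=> [s|s t|t s u]; rewrite /pres_eqb.
- by apply/asboolP; exact: pres_refl.
- by apply/asboolP/asboolP => /pres_sym.
- by move=> /asboolP h1 /asboolP h2; apply/asboolP; exact: pres_trans h1 h2.
Qed.
Canonical pres_equiv := EquivRelPack pres_eqb_equiv.
Canonical pres_encModRel := defaultEncModRel pres_eqb.

Definition pres := {eq_quot pres_eqb}.
HB.instance Definition _ := Choice.on pres.
HB.instance Definition _ : EqQuotient _ pres_eqb pres := EqQuotient.on pres.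

Definition pcls s : pres := \pi_pres s.

Lemma pclsP s t : pcls s = pcls t <-> pres_eq s t.
Proof.
rewrite /pcls; split => [/eqP|h].
  by rewrite piE => /asboolP.
by apply/eqP; rewrite piE; apply/asboolP.
Qed.

Lemma pcls_repr (x : pres) : pcls (repr x) = x. Proof. exact: reprK. Qed.

Definition padd (x y : pres) := pcls (repr x ++ repr y).
Definition pscale a (x : pres) := pcls (fscale a (repr x)).

Lemma repr_pcls s : pres_eq (repr (pcls s)) s.
Proof. by apply/pclsP; rewrite pcls_repr. Qed.

Lemma paddE s t : padd (pcls s) (pcls t) = pcls (s ++ t).
Proof. by apply/pclsP/pres_cat; exact: repr_pcls. Qed.
Lemma pscaleE a s : pscale a (pcls s) = pcls (fscale a s).
Proof. by apply/pclsP/pres_scale/repr_pcls. Qed.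

Lemma paddA : associative padd.
Proof.
move=> x y z; rewrite -[x]pcls_repr -[y]pcls_repr -[z]pcls_repr.
by rewrite !paddE catA.
Qed.
Lemma paddC : commutative padd.
Proof. by move=> x y; apply/pclsP/pres_comm. Qed.
Lemma padd0 : left_id (pcls [::]) padd.
Proof. by move=> x; rewrite -[x]pcls_repr paddE. Qed.

HB.instance Definition _ := GRing.isNmodule.Build pres paddA paddC padd0.

Lemma pcls_cat s t : pcls (s ++ t) = pcls s + pcls t.
Proof. by rewrite -paddE. Qed.
Lemma pcls_cons p s : pcls (p :: s) = pcls [:: p] + pcls s.
Proof. by rewrite -pcls_cat. Qed.
Lemma pcls_coefD a b x : pcls [:: (a + b, x)] = pcls [:: (a, x)] + pcls [:: (b, x)].
Proof. by rewrite -pcls_cat; apply/pclsP/pres_coefD. Qed.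
Lemma pcls_coef0 x : pcls [:: (0, x)] = 0.
Proof. exact/pclsP/pres_coef0. Qed.

Lemma pscaleDl x : {morph pscale^~ x : a b / a + b}.
Proof.
move=> a b; rewrite -[x]pcls_repr !pscaleE.
elim: (repr x) => [|[c y] s IH] /=; first by rewrite addr0.
rewrite pcls_cons IH (pcls_cons (a * c, y)) (pcls_cons (b * c, y)).
by rewrite mulrDl pcls_coefD addrACA.
Qed.

Lemma pscale0 x : pscale 0 x = 0.
Proof.
rewrite -[x]pcls_repr pscaleE; elim: (repr x) => [|[c y] s IH] //=.
by rewrite pcls_cons IH mul0r pcls_coef0 addr0.
Qed.

Lemma pscale1 : left_id 1 pscale.
Proof.
move=> x; rewrite -[x]pcls_repr pscaleE /fscale; congr pcls.
by rewrite -[RHS]map_id; apply: eq_map => -[a y] /=; rewrite mul1r.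
Qed.

Lemma paddN : left_inverse 0 (pscale (-1)) +%R.
Proof. by move=> x; rewrite -{2}[x]pscale1 -pscaleDl addNr pscale0. Qed.
HB.instance Definition _ := GRing.Nmodule_isZmodule.Build pres paddN.

Lemma pscaleA a b x : pscale a (pscale b x) = pscale (a * b) x.
Proof.
rewrite -[x]pcls_repr !pscaleE /fscale -map_comp; congr pcls.
by apply: eq_map => -[c y] /=; rewrite mulrA.
Qed.
Lemma pscaleDr : right_distributive pscale +%R.
Proof.
move=> a x y; rewrite -[x]pcls_repr -[y]pcls_repr -pcls_cat !pscaleE.
by rewrite /fscale map_cat pcls_cat.
Qed.
HB.instance Definition _ :=
  GRing.Zmodule_isLmodule.Build K pres pscaleA pscale1 pscaleDr pscaleDl.

Definition pgen (x : T) : pres := pcls [:: (1, x)].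

Lemma pcls_sum s : pcls s = \sum_(p <- s) p.1 *: pgen p.2.
Proof.
elim: s => [|[a x] s IH]; first by rewrite big_nil.
rewrite pcls_cons big_cons IH; congr (_ + _).
by rewrite [RHS]pscaleE /= mulr1.
Qed.

Section Lift.
Variables (V : lmodType K) (f : T -> V).
Definition feval s : V := \sum_(p <- s) p.1 *: f p.2.
Hypothesis fR : forall s t, R s t -> feval s = feval t.

Lemma feval_eq s t : pres_eq s t -> feval s = feval t.
Proof.
elim=> {s t} [//|//|s t u _ -> //|s s' t t' _ h _ h'|s t|a s t _ h|a b x|x|//].
- by rewrite /feval !big_cat /= -!/(feval _) h h'.
- by rewrite /feval !big_cat /= addrC.
- have E u : feval (fscale a u) = a *: feval u.
    rewrite /feval big_map scaler_sumr; apply: eq_bigr => p _.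
    by rewrite scalerA.
  by rewrite !E h.
- by rewrite /feval !big_cons big_nil !addr0 scalerDl.
- by rewrite /feval big_cons big_nil scale0r addr0.
Qed.

Definition plift_fun (x : pres) : V := feval (repr x).

Lemma plift_pcls s : plift_fun (pcls s) = feval s.
Proof. exact/feval_eq/repr_pcls. Qed.

Lemma plift_linear : linear plift_fun.
Proof.
move=> a x y; rewrite -[x]pcls_repr -[y]pcls_repr [_ *: _]pscaleE -pcls_cat.
rewrite !plift_pcls /feval big_cat big_map scaler_sumr; congr (_ + _).
by apply: eq_bigr => p _; rewrite scalerA.
Qed.

Definition plift : {linear pres -> V} := lin plift_linear.
Lemma pliftE x : plift (pgen x) = f x.
Proof. by rewrite linE plift_pcls /feval big_cons big_nil scale1r addr0. Qed.
End Lift.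

Lemma pres_ext (V : lmodType K) (f g : {linear pres -> V}) :
  (forall x, f (pgen x) = g (pgen x)) -> f =1 g.
Proof.
move=> fg x; rewrite -[x]pcls_repr pcls_sum !linear_sum.
by apply: eq_bigr => p _; rewrite !linearZ fg.
Qed.
End Presented.

Section QuotientModule.
(* [S] is any set of generators: [quot S] is V modulo the submodule it spans. *)
Variables (K : pzRingType) (V : lmodType K) (S : V -> Prop).

Inductive span : V -> Prop :=
| span0 : span 0
| spanP a x y : S x -> span y -> span (a *: x + y).

Definition span_pred : {pred V} := fun x => `[< span x >].

Lemma spanD x y : span x -> span y -> span (x + y).
Proof. by elim=> [|a z t Sz _ IH] ys; rewrite ?add0r -?addrA //; apply: spanP; auto. Qed.
Lemma spanZ b x : span x -> span (b *: x).
Proof.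
elim=> [|a z t Sz _ IH]; first by rewrite scaler0; exact: span0.
by rewrite scalerDr scalerA; exact: spanP.
Qed.
Lemma span_incl x : S x -> span x.
Proof. by move=> Sx; rewrite -[x]addr0 -[x]scale1r; apply: spanP => //; exact: span0. Qed.

Lemma span_zmod : zmod_closed span_pred.
Proof.
split=> [|x y]; first exact/asboolP/span0.
move=> /asboolP xs /asboolP ys; apply/asboolP/spanD => //.
by rewrite -scaleN1r; exact: spanZ.
Qed.
HB.instance Definition _ := GRing.isZmodClosed.Build V span_pred span_zmod.

Definition quot : Type := Quotient.quot span_pred.
HB.instance Definition _ := GRing.Zmodule.on quot.

Definition qcls (x : V) : quot := \pi_(Quotient.quot span_pred) x.

Lemma qclsP x y : qcls x = qcls y <-> span (x - y).
Proof.
rewrite /qcls; split=> [/eqP|h]; last apply/eqP.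
  by rewrite -Quotient.idealrBE => /asboolP.
by rewrite -Quotient.idealrBE; apply/asboolP.
Qed.
Lemma qcls_repr (x : quot) : qcls (repr x) = x. Proof. exact: reprK. Qed.
Lemma qclsD x y : qcls (x + y) = qcls x + qcls y. Proof. exact: raddfD. Qed.

Definition qscale a (x : quot) : quot := qcls (a *: repr x).
Lemma qscaleE a x : qscale a (qcls x) = qcls (a *: x).
Proof.
apply/qclsP; rewrite -scalerBr; apply/spanZ/qclsP; exact: qcls_repr.
Qed.
Lemma qscaleA a b x : qscale a (qscale b x) = qscale (a * b) x.
Proof. by rewrite -[x]qcls_repr !qscaleE scalerA. Qed.
Lemma qscale1 : left_id 1 qscale.
Proof. by move=> x; rewrite -[x]qcls_repr !qscaleE scale1r. Qed.
Lemma qscaleDr : right_distributive qscale +%R.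
Proof.
move=> a x y; rewrite -[x]qcls_repr -[y]qcls_repr -qclsD !qscaleE.
by rewrite scalerDr qclsD.
Qed.
Lemma qscaleDl x : {morph qscale^~ x : a b / a + b}.
Proof. by move=> a b; rewrite -[x]qcls_repr !qscaleE scalerDl qclsD. Qed.
HB.instance Definition _ :=
  GRing.Zmodule_isLmodule.Build K quot qscaleA qscale1 qscaleDr qscaleDl.

Lemma qcls_linear : linear qcls.
Proof. by move=> a x y; rewrite qclsD -qscaleE. Qed.
Definition qproj : {linear V -> quot} := lin qcls_linear.
End QuotientModule.

Section Kernel.
Variables (K : pzRingType) (V W : lmodType K) (f : {linear V -> W}).
Definition ker_pred : {pred V} := [pred x | f x == 0].
Lemma ker_submod : submod_closed ker_pred.
Proof.
split=> [|a x y]; rewrite !inE ?linear0 // => /eqP fx /eqP fy.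
by rewrite linearP fx fy scaler0 addr0.
Qed.
Record ker : Type := Ker { ker_val :> V; ker_valP : ker_val \in ker_pred }.
HB.instance Definition _ := [isSub for ker_val].
HB.instance Definition _ := [Choice of ker by <:].
HB.instance Definition _ :=
  GRing.SubChoice_isSubLmodule.Build K V ker_pred ker ker_submod.
End Kernel.

Section Tensor.
Variables (K : comPzRingType) (M N : lmodType K).

Inductive tensor_rel :
    seq (K * {classic (M * N)}) -> seq (K * {classic (M * N)}) -> Prop :=
| tensor_linl a x x' y :
    tensor_rel [:: (1, (a *: x + x', y))] [:: (a, (x, y)); (1, (x', y))]
| tensor_linr a x y y' :
    tensor_rel [:: (1, (x, a *: y + y'))] [:: (a, (x, y)); (1, (x, y'))].

Definition tensor : lmodType K := pres tensor_rel.
Definition tpure (x : M) (y : N) : tensor := pgen tensor_rel (x, y).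

Lemma tpure_linl y : linear (tpure^~ y).
Proof.
move=> a x x'; have /pclsP := pres_rel (tensor_linl a x x' y).
by rewrite !pcls_sum !big_cons !big_nil /= !addr0 !scale1r.
Qed.
Lemma tpure_linr x : linear (tpure x).
Proof.
move=> a y y'; have /pclsP := pres_rel (tensor_linr a x y y').
by rewrite !pcls_sum !big_cons !big_nil /= !addr0 !scale1r.
Qed.

Section Lift.
Variables (V : lmodType K) (b : M -> N -> V).
Hypotheses (bl : forall y, linear (b^~ y)) (br : forall x, linear (b x)).
Lemma tlift_rel s t : tensor_rel s t ->
  feval (fun p : M * N => b p.1 p.2) s = feval (fun p : M * N => b p.1 p.2) t.
Proof.
case=> [a x x' y|a x y y']; rewrite /feval !big_cons !big_nil /= !addr0.
  by rewrite !scale1r bl.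
by rewrite !scale1r br.
Qed.
Definition tlift : {linear tensor -> V} := plift tlift_rel.
Lemma tliftE x y : tlift (tpure x y) = b x y. Proof. exact: pliftE. Qed.
End Lift.

Lemma tensor_ext (V : lmodType K) (f g : {linear tensor -> V}) :
  (forall x y, f (tpure x y) = g (tpure x y)) -> f =1 g.
Proof. by move=> fg; apply: pres_ext => -[x y]; exact: fg. Qed.
End Tensor.
Lemma tpureDl (K : comPzRingType) (M N : lmodType K) (x x' : M) (y : N) :
  tpure (x + x') y = tpure x y + tpure x' y.
Proof. by have := tpure_linl y 1 x x'; rewrite !scale1r. Qed.
Lemma tpureZl (K : comPzRingType) (M N : lmodType K) a (x : M) (y : N) :
  tpure (a *: x) y = a *: tpure x y.
Proof. by rewrite -!(linE (@tpure_linl K M N y)) linearZ. Qed.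
Lemma tpure_suml (K : comPzRingType) (M N : lmodType K) I (r : seq I)
    (F : I -> M) (y : N) :
  tpure (\sum_(i <- r) F i) y = \sum_(i <- r) tpure (F i) y.
Proof.
rewrite -(linE (@tpure_linl K M N y)) linear_sum /=.
by apply: eq_bigr => i _; rewrite linE.
Qed.

Notation "x ⊗ y" := (tpure x y) (at level 40, left associativity).

Section TensorMaps.
Variables (K : comPzRingType).
Implicit Types M N P : lmodType K.

Lemma tmap_linl M M' N N' (f : {linear M -> M'}) (g : {linear N -> N'}) y :
  linear (fun x => f x ⊗ g y).
Proof. by move=> a x x'; rewrite linearP tpure_linl. Qed.
Lemma tmap_linr M M' N N' (f : {linear M -> M'}) (g : {linear N -> N'}) x :
  linear (fun y => f x ⊗ g y).
Proof. by move=> a y y'; rewrite linearP tpure_linr. Qed.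
Definition tmap M M' N N' (f : {linear M -> M'}) (g : {linear N -> N'}) :
  {linear tensor M N -> tensor M' N'} := tlift (tmap_linl f g) (tmap_linr f g).
End TensorMaps.

Section DirectSum.
Variables (K : comPzRingType) (I : Type) (V : I -> lmodType K).

Inductive dsum_rel :
    seq (K * {classic {i & V i}}) -> seq (K * {classic {i & V i}}) -> Prop :=
| dsum_lin i a (x y : V i) :
    dsum_rel [:: (1, existT (fun i => V i : Type) i (a *: x + y))]
             [:: (a, existT (fun i => V i : Type) i x);
                 (1, existT (fun i => V i : Type) i y)].

Definition dsum : lmodType K := pres dsum_rel.
Definition din_fun i (x : V i) : dsum :=
  pgen dsum_rel (existT (fun i => V i : Type) i x).
Lemma din_linear i : linear (@din_fun i).
Proof.
move=> a x y; have /pclsP := pres_rel (dsum_lin a x y).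
by rewrite !pcls_sum !big_cons !big_nil /= !addr0 !scale1r.
Qed.
Definition din i : {linear V i -> dsum} := lin (@din_linear i).
Lemma dinE i x : din i x = din_fun x. Proof. exact: linE. Qed.

Section Lift.
Variables (W : lmodType K) (f : forall i, {linear V i -> W}).
Lemma dlift_rel s t : dsum_rel s t ->
  feval (fun p : {i & V i} => f (tag p) (tagged p)) s =
  feval (fun p : {i & V i} => f (tag p) (tagged p)) t.
Proof.
case=> i a x y; rewrite /feval !big_cons !big_nil /= !addr0.
by rewrite !scale1r linearP.
Qed.
Definition dlift : {linear dsum -> W} := plift dlift_rel.
Lemma dliftE i (x : V i) : dlift (din i x) = f i x.
Proof. by rewrite dinE; exact: pliftE. Qed.
End Lift.

Lemma dsum_ext (W : lmodType K) (f g : {linear dsum -> W}) :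
  (forall i x, f (din i x) = g (din i x)) -> f =1 g.
Proof. by move=> fg; apply: pres_ext => -[i x]; have := fg i x; rewrite dinE. Qed.
End DirectSum.

Section Homology.
Variables (K : comPzRingType) (C : nat -> lmodType K).
Variable d : forall n, {linear C n.+1 -> C n}.

(* The differential out of degree n, zero in degree 0. *)
Definition dout n : {linear C n -> C n.-1} :=
  match n with 0 => \0 | n'.+1 => d n' end.
Definition homology n : lmodType K :=
  quot (fun z : ker (dout n) => exists y, val z = d n y).
End Homology.

Definition lmod_iso (K : comPzRingType) (V W : lmodType K) : Prop :=
  exists f : {linear V -> W}, bijective f.

(* Units of a commutative ring; MathComp's [GRing.unit] would force [K] to be
   nonzero. *)
Record unit_of (K : comPzRingType) := UnitOf {
  uval : K;
  uinv : K;
  uvalV : uval * uinv = 1 }.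

Definition unit_one (K : comPzRingType) : unit_of K := UnitOf (mulr1 1).

Record category := Category {
  ob : Type;
  hom : ob -> ob -> Type;
  idm : forall X, hom X X;
  comp : forall X Y Z, hom Y Z -> hom X Y -> hom X Z;
  comp_idl : forall X Y (f : hom X Y), comp (idm Y) f = f;
  comp_idr : forall X Y (f : hom X Y), comp f (idm X) = f;
  compA : forall X Y Z W (f : hom X Y) (g : hom Y Z) (h : hom Z W),
    comp h (comp g f) = comp (comp h g) f }.
Arguments idm {c} X.
Arguments comp {c X Y Z} g f : rename.
Notation "g ∘ f" := (comp g f) (at level 40, left associativity).

Record grading_category (K : comPzRingType) := GradingCategory {
  gcat :> category;
  alpha : forall X Y Z W : ob gcat,
    hom X Y -> hom Y Z -> hom Z W -> unit_of K;
  alphaP : forall (X0 X1 X2 X3 X4 : ob gcat) (f1 : hom X0 X1) (f2 : hom X1 X2)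
      (f3 : hom X2 X3) (f4 : hom X3 X4),
    uval (alpha f1 f2 f3) * uinv (alpha f1 f2 (f4 ∘ f3))
      * uval (alpha f1 (f3 ∘ f2) f4) * uinv (alpha (f2 ∘ f1) f3 f4)
      * uval (alpha f2 f3 f4) = 1 }.
Arguments alpha {K} g {X Y Z W} : rename.

Record looper (K : comPzRingType) (C : grading_category K) := Looper {
  eps : forall X Y : ob C, hom X Y -> hom Y X -> unit_of K;
  epsV : forall (X Y : ob C) (f : hom X Y) (g : hom Y X),
    uinv (eps f g) = uval (eps g f);
  epsP : forall (X Y Z : ob C) (f : hom X Y) (g : hom Y Z) (h : hom Z X),
    uval (alpha C f g h) * uval (eps f (h ∘ g))
      * (uval (alpha C g h f) * uval (eps g (f ∘ h)))
      * (uval (alpha C h f g) * uval (eps h (g ∘ f))) = 1 }.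
Arguments eps {K C} l {X Y} : rename.

(* A graded module is the family of its homogeneous parts, so that the module
   itself is the direct sum [gtot] below.  Morphisms that are equal but not
   convertible, such as [h ∘ (g ∘ f)] and [h ∘ g ∘ f], are handled by letting
   the degree of a tensor be any [k] with a proof of [g ∘ f = k]. *)
Definition gmod (K : comPzRingType) (C : category) :=
  forall X Y : ob C, hom X Y -> lmodType K.

Identity Coercion gmod_Funclass : gmod >-> Funclass.

Definition gmap (K : comPzRingType) (C : category) (M N : gmod K C) :=
  forall (X Y : ob C) (f : hom X Y), {linear M X Y f -> N X Y f}.
Notation "phi ⟨ x ⟩" := (phi _ _ _ x) (at level 8, only parsing).

Definition gid (K : comPzRingType) (C : category) (M : gmod K C) : gmap M M :=
  fun X Y f => idfun.
Definition gcomp (K : comPzRingType) (C : category) (M N P : gmod K C)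
    (phi : gmap N P) (psi : gmap M N) : gmap M P :=
  fun X Y f => phi X Y f \o psi X Y f.

Record arrow (C : category) := Arrow {
  asrc : ob C;
  atgt : ob C;
  amor : hom asrc atgt }.

Definition gtot (K : comPzRingType) (C : category) (M : gmod K C) : lmodType K :=
  dsum (fun i : arrow C => M _ _ (amor i)).

Definition gin (K : comPzRingType) (C : category) (M : gmod K C)
    (X Y : ob C) (f : hom X Y) : {linear M X Y f -> gtot M} :=
  din (fun i : arrow C => M _ _ (amor i)) (Arrow f).

Record factorization (C : category) (X Z : ob C) (k : hom X Z) := Factorization {
  fmid : ob C;
  ffst : hom X fmid;
  fsnd : hom fmid Z;
  factE : fsnd ∘ ffst = k }.

Section GradedTensor.
Variables (K : comPzRingType) (C : category).
Implicit Types M N : gmod K C.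

Definition gtensor M N : gmod K C := fun X Z k =>
  dsum (fun i : factorization k => tensor (M _ _ (ffst i)) (N _ _ (fsnd i))).

Definition gpure M N (X Y Z : ob C) (f : hom X Y) (g : hom Y Z) (k : hom X Z)
    (e : g ∘ f = k) (x : M _ _ f) (y : N _ _ g) : gtensor M N k :=
  din (fun i : factorization k => tensor (M _ _ (ffst i)) (N _ _ (fsnd i)))
      (Factorization e) (x ⊗ y).

Definition glift M N (X Z : ob C) (k : hom X Z) (V : lmodType K)
    (b : forall (Y : ob C) (f : hom X Y) (g : hom Y Z), g ∘ f = k ->
       {linear tensor (M _ _ f) (N _ _ g) -> V}) : {linear gtensor M N k -> V} :=
  dlift (fun i : factorization k => b _ _ _ (factE i)).

Lemma gliftE M N (X Y Z : ob C) (k : hom X Z) (V : lmodType K) b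
    (f : hom X Y) (g : hom Y Z) (e : g ∘ f = k) (x : M _ _ f) (y : N _ _ g) :
  @glift M N X Z k V b (gpure e x y) = b _ _ _ e (x ⊗ y).
Proof. exact: dliftE. Qed.

Lemma gtensor_ext M N (X Z : ob C) (k : hom X Z) (V : lmodType K)
    (p q : {linear gtensor M N k -> V}) :
  (forall Y (f : hom X Y) (g : hom Y Z) (e : g ∘ f = k) x y,
     p (gpure e x y) = q (gpure e x y)) -> p =1 q.
Proof.
move=> pq; apply: dsum_ext => -[Y f g e] t /=.
pose F := fun i : factorization k => tensor (M _ _ (ffst i)) (N _ _ (fsnd i)).
apply: (tensor_ext (f := p \o din F (Factorization e))
                   (g := q \o din F (Factorization e))) => x y /=.
exact: pq.
Qed.

Lemma gpure_linl M N X Y Z f g k e y :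
  linear (fun x => @gpure M N X Y Z f g k e x y).
Proof. by move=> a x x'; rewrite /gpure tpure_linl linearP. Qed.
Lemma gpure_linr M N X Y Z f g k e x :
  linear (@gpure M N X Y Z f g k e x).
Proof. by move=> a y y'; rewrite /gpure tpure_linr linearP. Qed.

Definition gtmap M M' N N' (phi : gmap M M') (psi : gmap N N') :
    gmap (gtensor M N) (gtensor M' N') := fun X Z k =>
  glift (fun Y f g e =>
    din (fun i : factorization k => tensor (M' _ _ (ffst i)) (N' _ _ (fsnd i)))
      (Factorization e) \o tmap (phi _ _ f) (psi _ _ g)).

Lemma gtmapE M M' N N' (phi : gmap M M') (psi : gmap N N')
    (X Y Z : ob C) (f : hom X Y) (g : hom Y Z) (k : hom X Z) (e : g ∘ f = k)
    (x : M _ _ f) (y : N _ _ g) :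
  (gtmap phi psi)⟨gpure e x y⟩ = gpure e phi⟨x⟩ psi⟨y⟩.
Proof. by rewrite gliftE /= tliftE. Qed.
End GradedTensor.
Notation "x ⊗[ e ] y" := (gpure e x y)
  (at level 40, left associativity, format "x  ⊗[ e ]  y").

Section Associator.
Variables (K : comPzRingType) (C : grading_category K).
Unset Implicit Arguments.
Variables (M N P : gmod K C).
Set Implicit Arguments.

Lemma comp_factl (X Y Z W : ob C) (f : hom X Y) (g : hom Y Z) (p : hom Z W)
    (h : hom X Z) (k : hom X W) : g ∘ f = h -> p ∘ h = k -> (p ∘ g) ∘ f = k.
Proof. by move=> <- <-; rewrite compA. Qed.
Lemma comp_factr (X Y Z W : ob C) (f : hom X Y) (g : hom Y Z) (p : hom Z W)
    (h : hom Y W) (k : hom X W) : p ∘ g = h -> h ∘ f = k -> p ∘ (g ∘ f) = k.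
Proof. by move=> <- <-; rewrite compA. Qed.

Section Out.
Variables (X Z W : ob C) (h : hom X Z) (p : hom Z W) (k : hom X W).
Hypothesis e : p ∘ h = k.

Lemma assoc_linl (z : P _ _ p) Y (f : hom X Y) (g : hom Y Z) (e' : g ∘ f = h) (y : N _ _ g) :
  linear (fun x : M _ _ f =>
    uval (alpha C f g p) *: (x ⊗[comp_factl e' e] (y ⊗[erefl (p ∘ g)] z))).
Proof. by move=> a x x'; rewrite gpure_linl scalerDr !scalerA mulrC. Qed.
Lemma assoc_linr (z : P _ _ p) Y (f : hom X Y) (g : hom Y Z) (e' : g ∘ f = h)
    (x : M _ _ f) :
  linear (fun y : N _ _ g =>
    uval (alpha C f g p) *: (x ⊗[comp_factl e' e] (y ⊗[erefl (p ∘ g)] z))).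
Proof. by move=> a y y'; rewrite gpure_linl gpure_linr scalerDr !scalerA mulrC. Qed.

Definition assoc_in (z : P _ _ p) :
    {linear gtensor M N h -> gtensor M (gtensor N P) k} :=
  glift (fun Y f g e' => tlift (assoc_linl z e') (assoc_linr z e')).

Lemma assoc_in_linear t : linear (fun z => assoc_in z t).
Proof.
move=> a z z'.
apply: (gtensor_ext (q := (a \*: assoc_in z) \+ assoc_in z'))
  => Y f g e' x y /=; rewrite !gliftE !tliftE.
by rewrite !gpure_linr scalerDr !scalerA mulrC.
Qed.
End Out.

(* (m ⊗ n) ⊗ p |-> α(|m|,|n|,|p|) m ⊗ (n ⊗ p) *)
Definition gassoc : gmap (gtensor (gtensor M N) P) (gtensor M (gtensor N P)) :=
  fun X W k => glift (fun Z h p e =>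
    tlift (b := fun t z => assoc_in e z t) (fun z => linearP (assoc_in e z))
          (assoc_in_linear e)).

Lemma gassocE (X Y Z W : ob C) (f : hom X Y) (g : hom Y Z) (p : hom Z W)
    (gf : hom X Z) (pg : hom Y W) (k : hom X W) (e1 : g ∘ f = gf)
    (e2 : p ∘ gf = k) (e3 : p ∘ g = pg) (e4 : pg ∘ f = k)
    (x : M _ _ f) (y : N _ _ g) (z : P _ _ p) :
  gassoc⟨(x ⊗[e1] y) ⊗[e2] z⟩ =
  uval (alpha C f g p) *: (x ⊗[e4] (y ⊗[e3] z)).
Proof.
rewrite gliftE tliftE gliftE tliftE.
by move: (comp_factl _ _) e4; case: pg / e3 => e e'; rewrite (Prop_irrelevance e e').
Qed.

Section In.
Variables (X Y W : ob C) (f : hom X Y) (h : hom Y W) (k : hom X W).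
Hypothesis e : h ∘ f = k.

Lemma associ_linl (x : M _ _ f) Z (g : hom Y Z) (p : hom Z W) (e' : p ∘ g = h)
    (z : P _ _ p) :
  linear (fun y : N _ _ g =>
    uinv (alpha C f g p) *: ((x ⊗[erefl (g ∘ f)] y) ⊗[comp_factr e' e] z)).
Proof. by move=> a y y'; rewrite gpure_linr gpure_linl scalerDr !scalerA mulrC. Qed.
Lemma associ_linr (x : M _ _ f) Z (g : hom Y Z) (p : hom Z W) (e' : p ∘ g = h)
    (y : N _ _ g) :
  linear (fun z : P _ _ p =>
    uinv (alpha C f g p) *: ((x ⊗[erefl (g ∘ f)] y) ⊗[comp_factr e' e] z)).
Proof. by move=> a z z'; rewrite gpure_linr scalerDr !scalerA mulrC. Qed.

Definition associ_in (x : M _ _ f) :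
    {linear gtensor N P h -> gtensor (gtensor M N) P k} :=
  glift (fun Z g p e' => tlift (associ_linl x e') (associ_linr x e')).

Lemma associ_in_linear t : linear (fun x => associ_in x t).
Proof.
move=> a x x'.
apply: (gtensor_ext (q := (a \*: associ_in x) \+ associ_in x'))
  => Z g p e' y z /=; rewrite !gliftE !tliftE.
by rewrite !gpure_linl scalerDr !scalerA mulrC.
Qed.
End In.

(* m ⊗ (n ⊗ p) |-> α(|m|,|n|,|p|)^-1 (m ⊗ n) ⊗ p *)
Definition gassoci : gmap (gtensor M (gtensor N P)) (gtensor (gtensor M N) P) :=
  fun X W k => glift (fun Y f h e =>
    tlift (associ_in_linear e) (fun x => linearP (associ_in e x))).

Lemma gassociE (X Y Z W : ob C) (f : hom X Y) (g : hom Y Z) (p : hom Z W)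
    (gf : hom X Z) (pg : hom Y W) (k : hom X W) (e1 : g ∘ f = gf)
    (e2 : p ∘ gf = k) (e3 : p ∘ g = pg) (e4 : pg ∘ f = k)
    (x : M _ _ f) (y : N _ _ g) (z : P _ _ p) :
  gassoci⟨x ⊗[e4] (y ⊗[e3] z)⟩ =
  uinv (alpha C f g p) *: ((x ⊗[e1] y) ⊗[e2] z).
Proof.
rewrite gliftE tliftE gliftE tliftE.
by move: (comp_factr _ _) e2; case: gf / e1 => e e'; rewrite (Prop_irrelevance e e').
Qed.
End Associator.

Unset Implicit Arguments.
Record galg (K : comPzRingType) (C : grading_category K) := GAlg {
  gcar :> gmod K C;
  gmul : gmap (gtensor gcar gcar) gcar;
  gone : forall X : ob C, gcar X X (idm X);
  gmulA : forall (X Y Z W : ob C) (f : hom X Y) (g : hom Y Z) (h : hom Z W)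
      (gf : hom X Z) (hg : hom Y W) (k : hom X W) (e1 : g ∘ f = gf)
      (e2 : h ∘ gf = k) (e3 : h ∘ g = hg) (e4 : hg ∘ f = k)
      (x : gcar _ _ f) (y : gcar _ _ g) (z : gcar _ _ h),
    gmul⟨gmul⟨x ⊗[e1] y⟩ ⊗[e2] z⟩ =
    uval (alpha C f g h) *: gmul⟨x ⊗[e4] gmul⟨y ⊗[e3] z⟩⟩;
  gmul1l : forall (X Y : ob C) (f : hom X Y) (x : gcar _ _ f),
    gmul⟨gone X ⊗[comp_idr f] x⟩ = uinv (alpha C (idm X) (idm X) f) *: x;
  gmul1r : forall (X Y : ob C) (f : hom X Y) (x : gcar _ _ f),
    gmul⟨x ⊗[comp_idl f] gone Y⟩ = uval (alpha C f (idm Y) (idm Y)) *: x }.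
Set Implicit Arguments.
Arguments galg {K} C.
Arguments gmul {K C} A : rename.
Arguments gone {K C} A X : rename.

Section Bimodules.
Variables (K : comPzRingType) (C : grading_category K) (A B : galg C).

Unset Implicit Arguments.
Record gbimod_data := GBimodData {
  gbcar :> gmod K C;
  rhoL : gmap (gtensor A gbcar) gbcar;
  rhoR : gmap (gtensor gbcar B) gbcar }.

Set Implicit Arguments.

Record is_gbimod (M : gbimod_data) : Prop := IsGBimod {
  rhoLA : forall (X Y Z W : ob C) (f : hom X Y) (g : hom Y Z) (h : hom Z W)
      (gf : hom X Z) (hg : hom Y W) (k : hom X W) (e1 : g ∘ f = gf)
      (e2 : h ∘ gf = k) (e3 : h ∘ g = hg) (e4 : hg ∘ f = k)
      (a : A _ _ f) (a' : A _ _ g) (m : M _ _ h),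
    (rhoL M)⟨(gmul A)⟨a ⊗[e1] a'⟩ ⊗[e2] m⟩ =
    uval (alpha C f g h) *: (rhoL M)⟨a ⊗[e4] (rhoL M)⟨a' ⊗[e3] m⟩⟩;
  rhoRA : forall (X Y Z W : ob C) (f : hom X Y) (g : hom Y Z) (h : hom Z W)
      (gf : hom X Z) (hg : hom Y W) (k : hom X W) (e1 : g ∘ f = gf)
      (e2 : h ∘ gf = k) (e3 : h ∘ g = hg) (e4 : hg ∘ f = k)
      (m : M _ _ f) (b : B _ _ g) (b' : B _ _ h),
    (rhoR M)⟨(rhoR M)⟨m ⊗[e1] b⟩ ⊗[e2] b'⟩ =
    uval (alpha C f g h) *: (rhoR M)⟨m ⊗[e4] (gmul B)⟨b ⊗[e3] b'⟩⟩;
  rhoLRA : forall (X Y Z W : ob C) (f : hom X Y) (g : hom Y Z) (h : hom Z W)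
      (gf : hom X Z) (hg : hom Y W) (k : hom X W) (e1 : g ∘ f = gf)
      (e2 : h ∘ gf = k) (e3 : h ∘ g = hg) (e4 : hg ∘ f = k)
      (a : A _ _ f) (m : M _ _ g) (b : B _ _ h),
    (rhoR M)⟨(rhoL M)⟨a ⊗[e1] m⟩ ⊗[e2] b⟩ =
    uval (alpha C f g h) *: (rhoL M)⟨a ⊗[e4] (rhoR M)⟨m ⊗[e3] b⟩⟩;
  rhoL1 : forall (X Y : ob C) (f : hom X Y) (m : M _ _ f),
    (rhoL M)⟨gone A X ⊗[comp_idr f] m⟩ = uinv (alpha C (idm X) (idm X) f) *: m;
  rhoR1 : forall (X Y : ob C) (f : hom X Y) (m : M _ _ f),
    (rhoR M)⟨m ⊗[comp_idl f] gone B Y⟩ = uval (alpha C f (idm Y) (idm Y)) *: m }.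

Record gbimod := GBimod {
  gbdata :> gbimod_data;
  gbimodP : is_gbimod gbdata }.

Definition is_gbimod_hom (M N : gbimod_data) (phi : gmap M N) : Prop :=
  (forall (X Y Z : ob C) (f : hom X Y) (g : hom Y Z) (k : hom X Z)
      (e : g ∘ f = k) (a : A _ _ f) (m : M _ _ g),
    phi⟨(rhoL M)⟨a ⊗[e] m⟩⟩ = (rhoL N)⟨a ⊗[e] phi⟨m⟩⟩) /\
  (forall (X Y Z : ob C) (f : hom X Y) (g : hom Y Z) (k : hom X Z)
      (e : g ∘ f = k) (m : M _ _ f) (b : B _ _ g),
    phi⟨(rhoR M)⟨m ⊗[e] b⟩⟩ = (rhoR N)⟨phi⟨m⟩ ⊗[e] b⟩).
End Bimodules.
Arguments gbimod_data {K C} A B.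
Arguments GBimodData {K C A B} gbcar rhoL rhoR.
Arguments rhoL {K C A B} M : rename.
Arguments rhoR {K C A B} M : rename.

Section Bar.
Variables (K : comPzRingType) (C : grading_category K) (A : galg C).

(* [gpow n] is A^{⊗ n+1} parenthesized to the left.  The actions and the
   differential are defined by recursion on the last tensor factor; lemmas
   [gpowLE], [gpowRE] and [gpowdE] give their values on homogeneous tensors,
   which unroll to
     a · (a_0 ⊗ ... ⊗ a_{n+1}) =
       (\prod_(1 <= i <= n+1) α(|a|, |a_{i-1}|∘...∘|a_0|, |a_i|)^-1)
         μ(a,a_0) ⊗ a_1 ⊗ ... ⊗ a_{n+1},
     ∂ (a_0 ⊗ ... ⊗ a_{n+1}) = \sum_(0 <= i <= n) (-1)^i
       α(|a_{i-1}|∘...∘|a_0|, |a_i|, |a_{i+1}|)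
         a_0 ⊗ ... ⊗ μ(a_i,a_{i+1}) ⊗ ... ⊗ a_{n+1}.  *)
Fixpoint gpow n : gmod K C :=
  if n is n'.+1 then gtensor (gpow n') A else A.

Fixpoint gpowL n : gmap (gtensor A (gpow n)) (gpow n) :=
  match n with
  | 0 => gmul A
  | n'.+1 => gcomp (gtmap (gpowL n') (gid A)) (@gassoci K C A (gpow n') A)
  end.

Definition gpowR n : gmap (gtensor (gpow n) A) (gpow n) :=
  match n with
  | 0 => gmul A
  | n'.+1 => gcomp (gtmap (gid (gpow n')) (gmul A)) (@gassoc K C (gpow n') A A)
  end.

Fixpoint gpowd n : gmap (gpow n.+1) (gpow n) :=
  match n with
  | 0 => gmul A
  | n'.+1 => fun X Y f =>
      gtmap (gpowd n') (gid A) f \+ ((-1) ^+ n'.+1 \*: gpowR n'.+1 f)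
  end.

Section Recursion.
Variables (n : nat) (X Y Z W : ob C) (f : hom X Y) (g : hom Y Z) (h : hom Z W).
Variables (gf : hom X Z) (hg : hom Y W) (k : hom X W).
Hypotheses (e1 : g ∘ f = gf) (e2 : h ∘ gf = k) (e3 : h ∘ g = hg) (e4 : hg ∘ f = k).

Lemma gpowLE (a : A _ _ f) (t : @gpow n _ _ g) (x : A _ _ h) :
  (@gpowL n.+1)⟨a ⊗[e4] (t ⊗[e3] x)⟩ =
  uinv (alpha C f g h) *: ((@gpowL n)⟨a ⊗[e1] t⟩ ⊗[e2] x).
Proof. by rewrite /= (gassociE e1 e2) linearZ; congr (_ *: _); exact: gtmapE. Qed.

Lemma gpowRE (t : @gpow n _ _ f) (x : A _ _ g) (a : A _ _ h) :
  (@gpowR n.+1)⟨(t ⊗[e1] x) ⊗[e2] a⟩ =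
  uval (alpha C f g h) *: (t ⊗[e4] (gmul A)⟨x ⊗[e3] a⟩).
Proof.
by rewrite /= (gassocE e1 e2 e3 e4) linearZ; congr (_ *: _); exact: gtmapE.
Qed.

Lemma gpowdE (t : @gpow n.+1 _ _ f) (x : A _ _ g) :
  (@gpowd n.+1)⟨t ⊗[e1] x⟩ =
  (@gpowd n)⟨t⟩ ⊗[e1] x + (-1) ^+ n.+1 *: (@gpowR n.+1)⟨t ⊗[e1] x⟩.
Proof. by rewrite [LHS]/= gtmapE. Qed.
End Recursion.

Definition bar n : gbimod_data A A := 
  GBimodData (gpow n.+1) (gpowL n.+1) (gpowR n.+1).
Definition bar_d n : gmap (bar n.+1) (bar n) := gpowd n.+1.
End Bar.
Arguments bar_d {K C} A n X Y f : rename.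

Section HochschildTensor.
Variables (K : comPzRingType) (C : grading_category K) (E : looper C).
Variables (A : galg C).

(* The scalar Θ for |m| = f, |a| = h, |n| = g, |a'| = h'. *)
Definition theta (X Y Z W : ob C) (f : hom X Y) (h : hom Y Z) (g : hom Z W)
    (h' : hom W X) : K :=
  uval (alpha C h' (h ∘ f) g) * uval (eps E h' (g ∘ (h ∘ f)))
  * uval (alpha C f h g) * uval (alpha C f (g ∘ h) h').

Variables (M N : gbimod_data A A).

Definition htensor (X Y Z : ob C) (f : hom X Y) (g : hom Y Z)
    (m : M _ _ f) (n : N _ _ g) : gtot (gtensor M N) :=
  gin (gtensor M N) (g ∘ f) (m ⊗[erefl (g ∘ f)] n).

(* Tensors and products of non-composable degrees vanish, so a relation whose
   degrees do not close up to a loop keeps only one of its two terms (which may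
   therefore be normalized by any unit). *)
Inductive hochschild_rel : gtot (gtensor M N) -> Prop :=
| hrel_loop (X Y Z W : ob C) (f : hom X Y) (h : hom Y Z) (g : hom Z W)
    (h' : hom W X) (m : M _ _ f) (a : A _ _ h) (n : N _ _ g) (a' : A _ _ h') :
    hochschild_rel
      (htensor (rhoL M)⟨a' ⊗[erefl _] (rhoR M)⟨m ⊗[erefl _] a⟩⟩ n
       - theta f h g h' *:
         htensor m (rhoR N)⟨(rhoL N)⟨a ⊗[erefl _] n⟩ ⊗[erefl _] a'⟩)
| hrel_left (X X' Y Z W : ob C) (f : hom X Y) (h : hom Y Z) (g : hom Z W)
    (h' : hom X' X) (m : M _ _ f) (a : A _ _ h) (n : N _ _ g) (a' : A _ _ h') :
    W <> X' ->
    hochschild_rel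
      (htensor (rhoL M)⟨a' ⊗[erefl _] (rhoR M)⟨m ⊗[erefl _] a⟩⟩ n)
| hrel_right (X X' Y Z W : ob C) (f : hom X Y) (h : hom Y Z) (g : hom Z W)
    (h' : hom W X') (m : M _ _ f) (a : A _ _ h) (n : N _ _ g) (a' : A _ _ h') :
    X' <> X ->
    hochschild_rel
      (htensor m (rhoR N)⟨(rhoL N)⟨a ⊗[erefl _] n⟩ ⊗[erefl _] a'⟩).

(* M ⊗_{A ⊗ A^op} N *)
Definition tensorAe : lmodType K := quot hochschild_rel.

Definition tensorAe_pure (X Y Z : ob C) (f : hom X Y) (g : hom Y Z)
    (m : M _ _ f) (n : N _ _ g) : tensorAe :=
  qproj hochschild_rel (htensor m n).
End HochschildTensor.

(* The complex M ⊗_{A ⊗ A^op} B(A) with differential id ⊗ ∂. *)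
Record hochschild_complex (K : comPzRingType) (C : grading_category K)
    (E : looper C) (A : galg C) (M : gbimod A A) := HochschildComplex {
  hhd : forall n, {linear tensorAe E M (bar A n.+1) -> tensorAe E M (bar A n)};
  hhdE : forall n (X Y Z : ob C) (f : hom X Y) (g : hom Y Z)
      (m : M _ _ f) (b : bar A n.+1 _ _ g),
    hhd n (tensorAe_pure E m b) = tensorAe_pure E m (bar_d A n)⟨b⟩;
  hhdK : forall n x, hhd n (hhd n.+1 x) = 0 }.

Definition graded_HH (K : comPzRingType) (C : grading_category K)
    (E : looper C) (A : galg C) (M : gbimod A A)
    (D : hochschild_complex E M) (n : nat) : lmodType K :=
  homology (hhd D) n.

(* Not MathComp's [algType], which excludes the zero algebra. *)
Record assoc_alg (K : comPzRingType) := AssocAlg {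
  acar :> lmodType K;
  amul : {linear tensor acar acar -> acar};
  aone : acar;
  amulA : forall x y z, amul (amul (x ⊗ y) ⊗ z) = amul (x ⊗ amul (y ⊗ z));
  amul1l : forall x, amul (aone ⊗ x) = x;
  amul1r : forall x, amul (x ⊗ aone) = x }.

Record assoc_bimod (K : comPzRingType) (R : assoc_alg K) := AssocBimod {
  bcar :> lmodType K;
  actL : {linear tensor R bcar -> bcar};
  actR : {linear tensor bcar R -> bcar};
  actLA : forall r s m, actL (amul R (r ⊗ s) ⊗ m) = actL (r ⊗ actL (s ⊗ m));
  actRA : forall m r s, actR (actR (m ⊗ r) ⊗ s) = actR (m ⊗ amul R (r ⊗ s));
  actLRA : forall r m s, actR (actL (r ⊗ m) ⊗ s) = actL (r ⊗ actR (m ⊗ s));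
  actL1 : forall m, actL (aone R ⊗ m) = m;
  actR1 : forall m, actR (m ⊗ aone R) = m }.

Section ClassicalHochschild.
Variables (K : comPzRingType).

Section TensorAssoc.
Variables (M N P : lmodType K).
Lemma tassoc_linl (z : P) (y : N) : linear (fun x : M => x ⊗ (y ⊗ z)).
Proof. exact: tpure_linl. Qed.
Lemma tassoc_linr (z : P) (x : M) : linear (fun y : N => x ⊗ (y ⊗ z)).
Proof. by move=> a y y'; rewrite tpure_linl tpure_linr. Qed.
Definition tassoc_in (z : P) : {linear tensor M N -> tensor M (tensor N P)} :=
  tlift (tassoc_linl z) (tassoc_linr z).
Lemma tassoc_in_linear t : linear (fun z => tassoc_in z t).
Proof.
move=> a z z'.
apply: (tensor_ext (g := (a \*: tassoc_in z) \+ tassoc_in z')) => x y /=.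
by rewrite !tliftE !tpure_linr.
Qed.
(* (x ⊗ y) ⊗ z |-> x ⊗ (y ⊗ z) *)
Definition tassoc : {linear tensor (tensor M N) P -> tensor M (tensor N P)} :=
  tlift (b := fun t z => tassoc_in z t) (fun z => linearP (tassoc_in z))
        tassoc_in_linear.
Lemma tassocE x y z : tassoc (x ⊗ y ⊗ z) = x ⊗ (y ⊗ z).
Proof. by rewrite [LHS]tliftE [LHS]tliftE. Qed.
End TensorAssoc.

Variables (R : assoc_alg K) (N : assoc_bimod R).

(* The Hochschild chains N ⊗ R^{⊗ n}, parenthesized to the left. *)
Fixpoint hpow n : lmodType K := if n is n'.+1 then tensor (hpow n') R else N.

(* (m ⊗ a_1 ⊗ ... ⊗ a_n) · r = m ⊗ a_1 ⊗ ... ⊗ (a_n r) *)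
Definition hpowR n : {linear tensor (hpow n) R -> hpow n} :=
  match n with
  | 0 => actR N
  | n'.+1 => tmap (idfun : {linear hpow n' -> hpow n'}) (amul R)
             \o tassoc (hpow n') R R
  end.

Lemma actL_linear r : linear (fun m : N => actL N (r ⊗ m)).
Proof. by move=> a x y; rewrite tpure_linr linearP. Qed.

(* r · (m ⊗ a_1 ⊗ ... ⊗ a_n) = (r m) ⊗ a_1 ⊗ ... ⊗ a_n *)
Fixpoint hpowL (r : R) n : {linear hpow n -> hpow n} :=
  match n with
  | 0 => lin (actL_linear r)
  | n'.+1 => tmap (hpowL r n') (idfun : {linear R -> R})
  end.

Lemma hpowL_linear n t : linear (fun r => hpowL r n t).
Proof.
move=> a r s; elim: n t => [|n IH] /=.
  by move=> t; rewrite !linE tpure_linl linearP.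
apply: (tensor_ext (g := (a \*: tmap (hpowL r n) idfun) \+ tmap (hpowL s n) idfun))
  => x y /=.
by rewrite !tliftE /= IH tpure_linl.
Qed.

(* t ⊗ r |-> r · t *)
Definition hpow_cyc n : {linear hpow n.+1 -> hpow n} :=
  tlift (b := fun t r => hpowL r n t) (fun r => linearP (hpowL r n))
        (@hpowL_linear n).

(* The alternating sum of the faces other than the cyclic one. *)
Fixpoint hpow_inner n : {linear hpow n.+1 -> hpow n} :=
  match n with
  | 0 => actR N
  | n'.+1 => tmap (hpow_inner n') (idfun : {linear R -> R})
             \+ ((-1) ^+ n'.+1 \*: hpowR n'.+1)
  end.

Definition hochschild_d n : {linear hpow n.+1 -> hpow n} :=
  hpow_inner n \+ ((-1) ^+ n.+1 \*: hpow_cyc n).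

Definition HH (n : nat) : lmodType K := homology hochschild_d n.

(* [hchain m a n] is m ⊗ a_0 ⊗ ... ⊗ a_(n-1); on such elements [hochschild_d] is
   the usual Hochschild boundary, see [hochschild_dE]. *)
Fixpoint hchain (m : N) (a : nat -> R) n : hpow n :=
  match n with 0 => m | n'.+1 => hchain m a n' ⊗ a n' end.

Definition hcontract (i : nat) (a : nat -> R) (j : nat) : R :=
  if (j < i)%N then a j else if j == i then amul R (a i ⊗ a i.+1) else a j.+1.

Lemma eq_hchain m a b n :
  (forall i, (i < n)%N -> a i = b i) -> hchain m a n = hchain m b n.
Proof.
elim: n => [//|n IH] ab /=; rewrite ab // IH // => i /ltnW; exact: ab.
Qed.

Lemma hpowR_chain m a r n :
  hpowR n.+1 (hchain m a n.+1 ⊗ r) = hchain m a n ⊗ amul R (a n ⊗ r).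
Proof. by rewrite /= tassocE tliftE. Qed.

Lemma hpowL_chain m a r n : hpowL r n (hchain m a n) = hchain (actL N (r ⊗ m)) a n.
Proof.
by elim: n => [|n IH] /=; [rewrite linE | rewrite tliftE IH].
Qed.

Lemma hpow_inner_chain m a n :
  hpow_inner n (hchain m a n.+1) =
  hchain (actR N (m ⊗ a 0)) (a \o succn) n
  + \sum_(i < n) (-1) ^+ i.+1 *: hchain m (hcontract i a) n.
Proof.
elim: n => [|n IH]; first by rewrite big_ord0 addr0.
rewrite [LHS]/= tliftE -/(hchain m a n.+1) IH /= tassocE tliftE /=.
rewrite tpureDl -addrA tpure_suml; congr (_ + _).
rewrite big_ord_recr /=; congr (_ + _ *: _).
  apply: eq_bigr => i _; rewrite tpureZl; congr (_ *: (_ ⊗ _)).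
  by rewrite /hcontract ltnNge ltnW ?ltnS //= gtn_eqF.
rewrite {2}/hcontract ltnn eqxx; congr (_ ⊗ _).
by apply: eq_hchain => i lt_in; rewrite /hcontract lt_in.
Qed.

Lemma hochschild_dE m a n :
  hochschild_d n (hchain m a n.+1) =
  hchain (actR N (m ⊗ a 0)) (a \o succn) n
  + \sum_(i < n) (-1) ^+ i.+1 *: hchain m (hcontract i a) n
  + (-1) ^+ n.+1 *: hchain (actL N (a n ⊗ m)) a n.
Proof.
rewrite [LHS]/= -/(hchain m a n.+1) -/(hpow n.+1) hpow_inner_chain.
by rewrite /hpow_cyc tliftE hpowL_chain.
Qed.
End ClassicalHochschild.

Section GroupGradings.
Variables (K : comPzRingType) (G : groupType).

Definition BG : category := {|
  ob := unit;
  hom := fun _ _ => G;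
  idm := fun _ => 1%g;
  comp := fun _ _ _ g f => (g * f)%g;
  comp_idl := fun _ _ => mul1g;
  comp_idr := fun _ _ => mulg1;
  compA := fun _ _ _ _ f g h => mulgA h g f |}.

Lemma BG_alphaP :
  uval (unit_one K) * uinv (unit_one K) * uval (unit_one K)
  * uinv (unit_one K) * uval (unit_one K) = 1.
Proof. by rewrite /= !mulr1. Qed.

Definition BG1 : grading_category K :=
  @GradingCategory K BG (fun _ _ _ _ _ _ _ => unit_one K)
    (fun _ _ _ _ _ _ _ _ _ => BG_alphaP).

Lemma BG_epsP :
  uval (unit_one K) * uval (unit_one K) * (uval (unit_one K) * uval (unit_one K))
  * (uval (unit_one K) * uval (unit_one K)) = 1.
Proof. by rewrite /= !mulr1. Qed.

Definition BG11 : looper BG1 :=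
  @Looper K BG1 (fun _ _ _ _ => unit_one K) (fun _ _ _ _ => erefl)
    (fun _ _ _ _ _ _ => BG_epsP).

(* The associative algebra [R] is G-graded with homogeneous parts [A]:
   R = ⊕_g A_g, with the product of degree-g and degree-h elements in degree
   |y| ∘ |x| = h g, as for any graded algebra over [BG]; passing to the opposite
   group gives the convention with g h. *)
Record graded_algebra_by (R : assoc_alg K) (A : galg BG1) := GradedAlgebraBy {
  ingA : forall g : G, {linear A tt tt g -> R};
  ingA_dsum : bijective (dlift ingA);
  ingA_mul : forall (g h : G) (x : A tt tt g) (y : A tt tt h),
    ingA (h * g)%g ((gmul A)⟨@gpure K BG A A tt tt tt g h _ erefl x y⟩) =
    amul R (ingA g x ⊗ ingA h y);
  ingA_one : ingA 1%g (gone A tt) = aone R }.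

Record graded_bimodule_by (R : assoc_alg K) (N : assoc_bimod R) (A : galg BG1)
    (i : graded_algebra_by R A) (M : gbimod A A) := GradedBimoduleBy {
  ingM : forall g : G, {linear M tt tt g -> N};
  ingM_dsum : bijective (dlift ingM);
  ingM_actL : forall (g h : G) (a : A tt tt g) (m : M tt tt h),
    ingM (h * g)%g ((rhoL M)⟨@gpure K BG A M tt tt tt g h _ erefl a m⟩) =
    actL N (ingA i g a ⊗ ingM h m);
  ingM_actR : forall (g h : G) (m : M tt tt g) (a : A tt tt h),
    ingM (h * g)%g ((rhoR M)⟨@gpure K BG M A tt tt tt g h _ erefl m a⟩) =
    actR N (ingM g m ⊗ ingA i h a) }.
End GroupGradings.

(* Main.v *)
(* Extending a bimodule M by a right tensor factor A gives again a bimodule, by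
   the cocycle identity for α, so the bar terms are bimodules by induction; the
   differential satisfies ∂(t ⊗ x) = ∂t ⊗ x ± t · x, from which its linearity
   and ∂∂ = 0 follow.  A degree-preserving bimodule map carries the relations of
   M ⊗_{A ⊗ A^op} - to relations with the same Θ, hence id ⊗ ∂ descends.

   For G-graded A all scalars are 1, and
     m ⊗ (a_0 ⊗ ... ⊗ a_{n+1}) |-> (a_{n+1} m a_0) ⊗ a_1 ⊗ ... ⊗ a_n
   is an isomorphism onto the classical Hochschild complex, with inverse
     m ⊗ a_1 ⊗ ... ⊗ a_n |-> m ⊗ (1 ⊗ a_1 ⊗ ... ⊗ a_n ⊗ 1). *)

Require Import Defs.
From mathcomp Require Import all_boot all_order all_algebra ring.
Import Defs.

Set Implicit Arguments.
Unset Strict Implicit.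
Unset Printing Implicit Defensive.
Import GRing.Theory.
Local Open Scope ring_scope.

(** * The bar complex *)

Lemma uvalI (K : comPzRingType) (u : unit_of K) (x y : K) :
  uval u * x = uval u * y -> x = y.
Proof.
move=> h; rewrite -[x]mul1r -[y]mul1r -(uvalV u) [uval u * _]mulrC.
by rewrite -!mulrA h.
Qed.

Lemma uinvV (K : comPzRingType) (u : unit_of K) : uinv u * uval u = 1.
Proof. by rewrite mulrC uvalV. Qed.

Lemma uinvM (K : comPzRingType) (a b c : unit_of K) :
  uval a * uval b = uval c -> uinv a * uinv b = uinv c.
Proof.
move=> h; apply: (uvalI (u := c)); rewrite uvalV -h.
rewrite [LHS](_ : _ = (uval a * uinv a) * (uval b * uinv b)); last ring.
by rewrite !uvalV mulr1.
Qed.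

(** * The cocycle identity for α *)

Section Cocycle.
Variables (K : comPzRingType) (C : grading_category K).
Variables (X0 X1 X2 X3 X4 : ob C).
Variables (f1 : hom X0 X1) (f2 : hom X1 X2) (f3 : hom X2 X3) (f4 : hom X3 X4).
Variables (f21 : hom X0 X2) (f32 : hom X1 X3) (f43 : hom X2 X4).
Hypotheses (e21 : f2 ∘ f1 = f21) (e32 : f3 ∘ f2 = f32) (e43 : f4 ∘ f3 = f43).

(** [alphaP] with its inverses multiplied away. The composites are arbitrary morphisms with proofs,
    so that the identity applies to degrees that are only propositionally equal. *)
Lemma alpha_cocycle :
  uval (alpha C f1 f2 f3) * uval (alpha C f1 f32 f4) * uval (alpha C f2 f3 f4)
  = uval (alpha C f21 f3 f4) * uval (alpha C f1 f2 f43).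
Proof.
have := alphaP f1 f2 f3 f4; rewrite e21 e32 e43.
move/(congr1 ( *%R (uval (alpha C f21 f3 f4) * uval (alpha C f1 f2 f43)))).
rewrite mulr1 => <-.
set a := alpha C f1 f2 f3; set b := alpha C f1 f2 f43.
set c := alpha C _ f32 _; set d := alpha C f21 _ _; set e := alpha C f2 f3 f4.
transitivity ((uval b * uinv b) * (uval d * uinv d) * (uval a * uval c * uval e)).
  by rewrite !uvalV !mul1r.
ring.
Qed.
End Cocycle.

Section CocycleInverse.
Variables (K : comPzRingType) (a b c d e : unit_of K).
Hypothesis h : uval a * uval c * uval e = uval d * uval b.

(** The left action on M ⊗ A carries an inverse of α. This form of the cocycle identity serves the
    associativity of that action; [cocycle_invad] serves its compatibility with the right action. *)
Lemma cocycle_invda : uinv d * uval a = uval b * uinv e * uinv c.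
Proof.
transitivity (uinv d * (uval a * uval c * uval e) * (uinv c * uinv e)).
  rewrite [RHS](_ : _ = uinv d * uval a * (uval c * uinv c) * (uval e * uinv e)).
    by rewrite !uvalV !mulr1.
  by ring.
rewrite h [LHS](_ : _ = uval d * uinv d * (uval b * uinv e * uinv c)); last ring.
by rewrite uvalV mul1r.
Qed.

Lemma cocycle_invad : uinv a * uval d = uval c * uval e * uinv b.
Proof.
transitivity (uinv a * (uval d * uval b) * uinv b).
  by rewrite -!mulrA uvalV mulr1.
rewrite -h [LHS](_ : _ = uval a * uinv a * (uval c * uval e * uinv b)); last ring.
by rewrite uvalV mul1r.
Qed.
End CocycleInverse.

(** * Bilinearity of graded tensors *)

Section PureLinear.
Variables (K : comPzRingType) (C : category).
Unset Implicit Arguments.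
Variables (M N : gmod K C).
Set Implicit Arguments.
Variables (X Y Z : ob C) (f : hom X Y) (g : hom Y Z) (k : hom X Z).
Variable e : g ∘ f = k.

Definition gpureL (y : N _ _ g) : {linear M _ _ f -> gtensor M N k} :=
  lin (gpure_linl e y).
Definition gpureR (x : M _ _ f) : {linear N _ _ g -> gtensor M N k} :=
  lin (gpure_linr e x).

Lemma gpureLE (x : M _ _ f) (y : N _ _ g) : gpureL y x = x ⊗[e] y.
Proof. exact: linE. Qed.
Lemma gpureRE (x : M _ _ f) (y : N _ _ g) : gpureR x y = x ⊗[e] y.
Proof. exact: linE. Qed.
Lemma gpureZl a (x : M _ _ f) (y : N _ _ g) : (a *: x) ⊗[e] y = a *: (x ⊗[e] y).
Proof. by rewrite -!gpureLE linearZ. Qed.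
Lemma gpureZr a (x : M _ _ f) (y : N _ _ g) : x ⊗[e] (a *: y) = a *: (x ⊗[e] y).
Proof. by rewrite -!gpureRE linearZ. Qed.
Lemma gpureDl (x x' : M _ _ f) (y : N _ _ g) :
  (x + x') ⊗[e] y = x ⊗[e] y + x' ⊗[e] y.
Proof. by rewrite -!gpureLE linearD. Qed.
Lemma gpureDr (x : M _ _ f) (y y' : N _ _ g) :
  x ⊗[e] (y + y') = x ⊗[e] y + x ⊗[e] y'.
Proof. by rewrite -!gpureRE linearD. Qed.
Lemma gpure0l (y : N _ _ g) : (0 : M _ _ f) ⊗[e] y = 0.
Proof. by rewrite -gpureLE linear0. Qed.
Lemma gpure0r (x : M _ _ f) : x ⊗[e] (0 : N _ _ g) = 0.
Proof. by rewrite -gpureRE linear0. Qed.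
End PureLinear.

(** * Induction on generators *)

Section Induction.
Variable K : comPzRingType.

Lemma pres_ind (T : Type) R (P : @pres K T R -> Prop) :
  P 0 -> (forall x y, P x -> P y -> P (x + y)) ->
  (forall a x, P (a *: pgen R x)) -> forall x, P x.
Proof.
move=> P0 PD PZ x; rewrite -[x]pcls_repr pcls_sum.
by elim/big_ind: _ => // p _; apply: PZ.
Qed.

(** A scalar multiple of a pure tensor is again pure, because the scalar moves into the left factor;
    hence sums of pure tensors exhaust the module. *)
Lemma tensor_ind (M N : lmodType K) (P : tensor M N -> Prop) :
  P 0 -> (forall x y, P x -> P y -> P (x + y)) ->
  (forall x y, P (x ⊗ y)) -> forall x, P x.
Proof.
move=> P0 PD Pp; apply: pres_ind => // a [x y].
by have := Pp (a *: x) y; rewrite tpureZl.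
Qed.

Lemma dsum_ind (I : Type) (V : I -> lmodType K) (P : dsum V -> Prop) :
  P 0 -> (forall x y, P x -> P y -> P (x + y)) ->
  (forall i x, P (din V i x)) -> forall x, P x.
Proof.
move=> P0 PD Pp; apply: pres_ind => // a [i x].
by have := Pp i (a *: x); rewrite linearZ /= dinE.
Qed.

Lemma gtensor_ind (C : category) (M N : gmod K C) (X Z : ob C) (k : hom X Z)
    (P : gtensor M N k -> Prop) :
  P 0 -> (forall x y, P x -> P y -> P (x + y)) ->
  (forall Y (f : hom X Y) (g : hom Y Z) (e : g ∘ f = k) x y, P (x ⊗[e] y)) ->
  forall x, P x.
Proof.
move=> P0 PD Pp; apply: dsum_ind => // -[Y f g e] /=.
apply: tensor_ind => [|x y Px Py|x y]; first by rewrite linear0.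
  by rewrite linearD; apply: PD.
exact: Pp.
Qed.

Lemma gtot_ind (C : category) (M : gmod K C) (P : gtot M -> Prop) :
  P 0 -> (forall x y, P x -> P y -> P (x + y)) ->
  (forall X Y (f : hom X Y) x, P (gin M f x)) -> forall x, P x.
Proof. by move=> P0 PD Pp; apply: dsum_ind => // -[X Y f]; apply: Pp. Qed.
End Induction.

(** * The bimodule M ⊗ A *)

Section Extension.
Variables (K : comPzRingType) (C : grading_category K) (A : galg C).

(** Applied to A^{⊗ n+1} this is convertible with A^{⊗ n+2} and its two actions, which turns the
    bimodule axioms for the bar terms into a plain induction. *)
Definition gext (M : gbimod_data A A) : gbimod_data A A :=
  GBimodData (gtensor M A)
    (gcomp (gtmap (rhoL M) (gid A)) (@gassoci K C A M A))
    (gcomp (gtmap (gid M) (gmul A)) (@gassoc K C M A A)).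

Variable M : gbimod_data A A.

Section Values.
Variables (X Y Z W : ob C) (f : hom X Y) (g : hom Y Z) (h : hom Z W).
Variables (gf : hom X Z) (hg : hom Y W) (k : hom X W).
Hypotheses (e1 : g ∘ f = gf) (e2 : h ∘ gf = k).
Hypotheses (e3 : h ∘ g = hg) (e4 : hg ∘ f = k).

Lemma gextL (a : A _ _ f) (t : M _ _ g) (x : A _ _ h) :
  (rhoL (gext M))⟨a ⊗[e4] (t ⊗[e3] x)⟩ =
  uinv (alpha C f g h) *: ((rhoL M)⟨a ⊗[e1] t⟩ ⊗[e2] x).
Proof. by rewrite /= (gassociE e1 e2) linearZ; congr (_ *: _); exact: gtmapE. Qed.

Lemma gextR (t : M _ _ f) (x : A _ _ g) (a : A _ _ h) :
  (rhoR (gext M))⟨(t ⊗[e1] x) ⊗[e2] a⟩ =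
  uval (alpha C f g h) *: (t ⊗[e4] (gmul A)⟨x ⊗[e3] a⟩).
Proof.
by rewrite /= (gassocE e1 e2 e3 e4) linearZ; congr (_ *: _); exact: gtmapE.
Qed.
End Values.

Hypothesis Mb : is_gbimod M.

(** On [t ⊗ x] the left action changes only [t] and the right action only [x]. Left axioms thus
    reduce to those of [M], right axioms to those of the algebra [A], and the mixed axiom to an
    equality of scalars. The scalars match by the cocycle identity. *)
Lemma gext_bimod : is_gbimod (gext M).
Proof.
split.
- move=> X Y Z W f g h gf hg k e1 e2 e3 e4 a a'.
  elim/gtensor_ind => [|m m' IH IH'|V u v e t x].
  + by rewrite !(gpure0r, linear0, scaler0).
  + by rewrite !(gpureDr, linearD, scalerDr) IH IH'.
  pose ug := u ∘ g; pose ugf := u ∘ gf.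
  have e5 : v ∘ ug = hg by rewrite /ug compA e.
  have e6 : ug ∘ f = ugf by rewrite /ug /ugf -e1 compA.
  have e7 : v ∘ ugf = k by rewrite /ugf compA e.
  rewrite (gextL (erefl ugf) e7) (gextL (erefl ug) e5).
  rewrite gpureZr linearZ_LR (gextL e6 e7) (rhoLA Mb e1 (erefl _) (erefl ug) e6).
  rewrite gpureZl !scalerA; congr (_ *: _).
  rewrite (cocycle_invda (alpha_cocycle e1 (erefl ug) e)); ring.
- move=> X Y Z W f g h gf hg k e1 e2 e3 e4 + b b'.
  elim/gtensor_ind => [|m m' IH IH'|V u v e t x].
  + by rewrite !(gpure0l, linear0, scaler0).
  + by rewrite !(gpureDl, linearD, scalerDr) IH IH'.
  pose gv := g ∘ v; pose hgv := hg ∘ v.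
  have e5 : gv ∘ u = gf by rewrite /gv -compA e.
  have e6 : h ∘ gv = hgv by rewrite /gv /hgv -e3 compA.
  have e7 : hgv ∘ u = k by rewrite /hgv -compA e.
  rewrite (gextR _ _ (erefl gv) e5) gpureZl linearZ_LR (gextR _ _ e6 e7).
  rewrite (gmulA _ _ _ _ _ _ _ _ _ _ _ _ _ _ e6 e3 (erefl hgv)) gpureZr.
  rewrite (gextR _ _ (erefl hgv) e7) !scalerA; congr (_ *: _).
  have h1 := alpha_cocycle e (erefl gv) e3.
  exact: h1.
- move=> X Y Z W f g h gf hg k e1 e2 e3 e4 a + b.
  elim/gtensor_ind => [|m m' IH IH'|V u v e t x].
  + by rewrite !(gpure0l, gpure0r, linear0, scaler0).
  + by rewrite !(gpureDl, gpureDr, linearD, scalerDr) IH IH'.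
  pose hv := h ∘ v; pose uf := u ∘ f.
  have e5 : hv ∘ u = hg by rewrite /hv -compA e.
  have e6 : v ∘ uf = gf by rewrite /uf compA e.
  have e7 : hv ∘ uf = k by rewrite /hv -compA e6.
  rewrite (gextL (erefl uf) e6) gpureZl linearZ_LR (gextR _ _ (erefl hv) e7).
  rewrite (gextR _ _ (erefl hv) e5) gpureZr linearZ_LR.
  rewrite (gextL (erefl uf) e7) !scalerA.
  congr (_ *: _).
  by rewrite (cocycle_invad (alpha_cocycle (erefl uf) e (erefl hv))).
- move=> X Y f.
  elim/gtensor_ind => [|m m' IH IH'|V u v e t x].
  + by rewrite !(gpure0r, linear0, scaler0).
  + by rewrite !(gpureDr, linearD, scalerDr) IH IH'.
  rewrite (gextL (comp_idr u) e) (rhoL1 Mb) gpureZl scalerA; congr (_ *: _).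
  (* The cocycle identity for (Id, Id, u, v) contains α(Id,u,v) twice on one side and once on the
     other; cancelling it leaves α(Id,Id,u) α(Id,u,v) = α(Id,Id,f). *)
  apply: uinvM; rewrite mulrC; apply: (uvalI (u := alpha C (idm X) u v)).
  by rewrite -(alpha_cocycle (comp_idl (idm X)) (comp_idr u) e); ring.
- move=> X Y f.
  elim/gtensor_ind => [|m m' IH IH'|V u v e t x].
  + by rewrite !(gpure0l, linear0, scaler0).
  + by rewrite !(gpureDl, linearD, scalerDr) IH IH'.
  rewrite (gextR _ _ (comp_idl v) e) gmul1r gpureZr scalerA; congr (_ *: _).
  (* Similarly (u, v, Id, Id) gives α(u,v,Id) α(v,Id,Id) = α(f,Id,Id) after cancelling α(u,v,Id). *)
  apply: (uvalI (u := alpha C u v (idm Y))).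
  by rewrite mulrA (alpha_cocycle e (comp_idl v) (comp_idl (idm Y))) mulrC.
Qed.
End Extension.

(* For abstract linear maps: [rewrite linearD] would unfold [gpowd]. *)
Lemma comp_lin0 (K : pzRingType) (U V W : lmodType K) (p : {linear V -> W})
    (q : {linear U -> V}) :
  p (q 0) = 0.
Proof. by rewrite !linear0. Qed.

Lemma comp_lin0D (K : pzRingType) (U V W : lmodType K) (p : {linear V -> W})
    (q : {linear U -> V}) x y :
  p (q x) = 0 -> p (q y) = 0 -> p (q (x + y)) = 0.
Proof. by move=> px py; rewrite !linearD px py addr0. Qed.

(** * The bar construction and its differential *)

Section BarConstruction.
Variables (K : comPzRingType) (C : grading_category K) (A : galg C).

Definition gpow_data n : gbimod_data A A :=
  GBimodData (gpow A n) (gpowL A n) (gpowR A n).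

Lemma gpow_bimod n : is_gbimod (gpow_data n).
Proof.
elim: n => [|n IH]; last exact: gext_bimod IH.
by split; [exact: gmulA|exact: gmulA|exact: gmulA|exact: gmul1l|exact: gmul1r].
Qed.

Lemma gpowd0 : @gpowd K C A 0 = gmul A. Proof. by []. Qed.
Lemma gpowL0 : @gpowL K C A 0 = gmul A. Proof. by []. Qed.
Lemma gpowR0 : @gpowR K C A 0 = gmul A. Proof. by []. Qed.

(** [gtensor_ind] phrased with [gpow], so that the cases match the recursion equations [gpowLE],
    [gpowRE] and [gpowdE]. *)
Lemma gpow_ind n (X Z : ob C) (k : hom X Z) (P : gpow A n.+1 k -> Prop) :
  P 0 -> (forall x y, P x -> P y -> P (x + y)) ->
  (forall Y (f : hom X Y) (g : hom Y Z) (e : g ∘ f = k)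
     (t : gpow A n f) (x : A _ _ g), P (t ⊗[e] x)) ->
  forall x, P x.
Proof. exact: gtensor_ind. Qed.

(** Split ∂(t ⊗ x) into ∂t ⊗ x and the signed t · x. The first summand is the induction hypothesis;
    for the second, the left and right actions on A^{⊗ n+2} commute up to the α that cancels the
    inverse produced by the left action. The base case is associativity of [A]. *)
Lemma gpowd_homL n (X Y Z : ob C) (f : hom X Y) (g : hom Y Z) (k : hom X Z)
    (e : g ∘ f = k) (a : A _ _ f) (m : gpow A n.+1 g) :
  (gpowd A n)⟨(gpowL A n.+1)⟨a ⊗[e] m⟩⟩ =
  (gpowL A n)⟨a ⊗[e] (gpowd A n)⟨m⟩⟩.
Proof.
elim: n X Y Z f g k e a m => [|n IH] X Y Z f g k e a;
  elim/gpow_ind => [|m m' IHm IHm'|V u v e' t x].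
- by rewrite gpure0r !linear0 gpure0r linear0.
- by rewrite gpureDr !linearD gpureDr linearD IHm IHm'.
- have e1 : v ∘ (u ∘ f) = k by rewrite compA e'.
  rewrite (gpowLE (erefl _) e1) linearZ_LR !gpowd0 gpowL0.
  rewrite (gmulA _ _ _ _ _ _ _ _ _ _ _ _ _ _ _ e' e) scalerA.
  by rewrite uinvV scale1r.
- by rewrite gpure0r !linear0 gpure0r linear0.
- by rewrite gpureDr !linearD gpureDr linearD IHm IHm'.
have e1 : v ∘ (u ∘ f) = k by rewrite compA e'.
rewrite (gpowLE (erefl _) e1) linearZ_LR !gpowdE IH gpureDr gpureZr scalerDr.
rewrite [RHS]linearD [in RHS]linearZ_LR (gpowLE (erefl _) e1); congr (_ + _).
rewrite !scalerA mulrC -scalerA; congr (_ *: _).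
rewrite (rhoLRA (gpow_bimod n.+1) _ _ e' e).
by rewrite scalerA uinvV scale1r.
Qed.

(** A case distinction suffices here: the right action changes only the last factor [x], so that the
    summand ∂t ⊗ x is immediate, and t · x is associativity of the right action. *)
Lemma gpowd_homR n (X Y Z : ob C) (f : hom X Y) (g : hom Y Z) (k : hom X Z)
    (e : g ∘ f = k) (m : gpow A n.+1 f) (b : A _ _ g) :
  (gpowd A n)⟨(gpowR A n.+1)⟨m ⊗[e] b⟩⟩ =
  (gpowR A n)⟨(gpowd A n)⟨m⟩ ⊗[e] b⟩.
Proof.
elim/gpow_ind: m => [|m m' IHm IHm'|V u v e' t x].
- by rewrite gpure0l !linear0 gpure0l linear0.
- by rewrite gpureDl !linearD gpureDl linearD IHm IHm'.
have e1 : (g ∘ v) ∘ u = k by rewrite -compA e'.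
rewrite (gpowRE _ _ (erefl _) e1) linearZ_LR.
case: n t => [|n] t.
  rewrite !gpowd0 gpowR0.
  by rewrite (gmulA _ _ _ _ _ _ _ _ _ _ _ _ _ e' _ (erefl _) e1).
rewrite !gpowdE gpureDl gpureZl scalerDr [RHS]linearD [in RHS]linearZ_LR.
rewrite (gpowRE _ _ (erefl _) e1); congr (_ + _).
rewrite !scalerA mulrC -scalerA; congr (_ *: _).
by rewrite (rhoRA (gpow_bimod n.+1) _ _ (erefl _) e1).
Qed.

(** Expanding ∂∂(t ⊗ x) gives ∂∂t ⊗ x, which vanishes by induction, and the terms ∂t · x and ∂(t ·
    x) with opposite signs, which cancel by right linearity of ∂. In the base case the two
    bracketings of a triple product cancel. *)
Lemma gpowdK n X Y (f : hom X Y) (x : gpow A n.+2 f) :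
  (gpowd A n)⟨(gpowd A n.+1)⟨x⟩⟩ = 0.
Proof.
elim: n X Y f x => [|n IH] X Y f; elim/gpow_ind => [|x y IHx IHy|Z g h e t x].
- exact: comp_lin0.
- exact: comp_lin0D.
- move: t; elim/gpow_ind => [|y y' IHy IHy'|Z' g' h' e' t y].
  + rewrite gpure0l; exact: comp_lin0.
  + rewrite gpureDl; exact: comp_lin0D.
  have e1 : (h ∘ h') ∘ g' = f by rewrite -compA e'.
  rewrite gpowdE (gpowRE _ _ (erefl _) e1) linearD linearZ_LR linearZ_LR !gpowd0.
  rewrite (gmulA _ _ _ _ _ _ _ _ _ _ _ _ _ e' _ (erefl _) e1).
  by rewrite expr1 scaleN1r subrr.
- exact: comp_lin0.
- exact: comp_lin0D.
rewrite gpowdE linearD linearZ_LR gpowdE IH gpure0l add0r gpowd_homR.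
by rewrite -scalerDl (exprS _ n.+1) mulN1r subrr scale0r.
Qed.
End BarConstruction.

(** * Maps out of quotient modules *)

Section QuotientLift.
Variables (K : comPzRingType) (V W : lmodType K) (S : V -> Prop).
Variable f : {linear V -> W}.
Hypothesis fS : forall x, S x -> f x = 0.

Lemma span_ker x : span S x -> f x = 0.
Proof.
by elim=> [|a y z Sy _ IH]; rewrite ?linear0 // linearP fS // IH scaler0 addr0.
Qed.

Lemma quot_lift_linear : linear (fun x : quot S => f (repr x)).
Proof.
have E x : f (repr (qcls S x)) = f x.
  apply/subr0_eq; rewrite -linearB; apply/span_ker/qclsP; exact: qcls_repr.
move=> a x y; rewrite -[x in LHS]qcls_repr -[y in LHS]qcls_repr.
by rewrite -qcls_linear E linearP.
Qed.
Definition quot_lift : {linear quot S -> W} := lin quot_lift_linear.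
Lemma quot_liftE x : quot_lift (qproj S x) = f x.
Proof.
rewrite !linE; apply/subr0_eq; rewrite -linearB; apply/span_ker/qclsP.
exact: qcls_repr.
Qed.
End QuotientLift.

Lemma quot_ind (K : comPzRingType) (V : lmodType K) (S : V -> Prop)
    (P : quot S -> Prop) :
  (forall x, P (qproj S x)) -> forall x, P x.
Proof. by move=> h x; rewrite -[x]qcls_repr; have := h (repr x); rewrite linE. Qed.

(** * The complex M ⊗_{A ⊗ A^op} B(A) *)

Section HochschildComplex.
Variables (K : comPzRingType).

Lemma qproj0 (V : lmodType K) (S : V -> Prop) x : S x -> qproj S x = 0.
Proof.
move=> Sx; rewrite -(linear0 (qproj S)) !linE; apply/qclsP; rewrite subr0.
exact: span_incl.
Qed.

Definition gtotmap (C : category) (M N : gmod K C) (phi : gmap M N) :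
    {linear gtot M -> gtot N} :=
  dlift (fun i : arrow C => gin N (amor i) \o phi _ _ (amor i)).

Lemma gtotmapE (C : category) (M N : gmod K C) (phi : gmap M N)
    (X Y : ob C) (f : hom X Y) (x : M _ _ f) :
  gtotmap phi (gin M f x) = gin N f phi⟨x⟩.
Proof. exact: dliftE. Qed.

Section Induced.
Variables (C : grading_category K) (E : looper C) (A : galg C).
Variables (M P Q : gbimod_data A A) (phi : gmap P Q).

Lemma gtotmap_htensor (X Y Z : ob C) (f : hom X Y) (g : hom Y Z)
    (m : M _ _ f) (x : P _ _ g) :
  gtotmap (gtmap (gid M) phi) (htensor m x) = htensor m phi⟨x⟩.
Proof. by rewrite /htensor gtotmapE gtmapE. Qed.

Lemma tensorAe_ind (F : tensorAe E M P -> Prop) :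
  F 0 -> (forall x y, F x -> F y -> F (x + y)) ->
  (forall (X Y Z : ob C) (f : hom X Y) (g : hom Y Z) (m : M _ _ f) (x : P _ _ g),
     F (tensorAe_pure E m x)) -> forall x, F x.
Proof.
move=> F0 FD Fp; apply: quot_ind; apply: gtot_ind => [|x y Fx Fy|X Z k].
- by rewrite linear0.
- by rewrite linearD; apply: FD.
apply: gtensor_ind => [|x y Fx Fy|Y f g e x y]; first by rewrite !linear0.
  by rewrite !linearD; apply: FD.
by case: k / e; apply: Fp.
Qed.

Hypothesis phi_hom : is_gbimod_hom phi.

Lemma hochschild_rel_map x : hochschild_rel E x ->
  qproj (hochschild_rel E (N := Q)) (gtotmap (gtmap (gid M) phi) x) = 0.
Proof.
case: phi_hom => phiL phiR.
case=> [X Y Z W f h g h' m a n a'|X X' Y Z W f h g h' m a n a' neq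
       |X X' Y Z W f h g h' m a n a' neq].
- rewrite linearB linearZ_LR !gtotmap_htensor phiR phiL.
  by apply: qproj0; apply: hrel_loop.
- by rewrite gtotmap_htensor; apply: qproj0; apply: hrel_left neq.
- by rewrite gtotmap_htensor phiR phiL; apply: qproj0; apply: hrel_right neq.
Qed.

Definition tensorAe_map : {linear tensorAe E M P -> tensorAe E M Q} :=
  quot_lift (f := qproj _ \o gtotmap (gtmap (gid M) phi)) hochschild_rel_map.

Lemma tensorAe_mapE (X Y Z : ob C) (f : hom X Y) (g : hom Y Z)
    (m : M _ _ f) (x : P _ _ g) :
  tensorAe_map (tensorAe_pure E m x) = tensorAe_pure E m phi⟨x⟩.
Proof. by rewrite quot_liftE /= gtotmap_htensor. Qed.
End Induced.

Variables (C : grading_category K) (E : looper C) (A : galg C).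

Lemma tensorAe_map_comp0 (M P Q R : gbimod_data A A) (phi : gmap P Q)
    (psi : gmap Q R) (phi_hom : is_gbimod_hom phi) (psi_hom : is_gbimod_hom psi) :
  (forall X Y (f : hom X Y) (x : P _ _ f), psi⟨phi⟨x⟩⟩ = 0) ->
  forall x, tensorAe_map E M psi_hom (tensorAe_map E M phi_hom x) = 0.
Proof.
move=> comp0 x; elim/tensorAe_ind: x => [|x y|X Y Z f g m x].
- exact: comp_lin0.
- exact: comp_lin0D.
rewrite !tensorAe_mapE comp0.
by rewrite /tensorAe_pure /htensor gpure0r !linear0.
Qed.

Lemma bar_d_hom n : @is_gbimod_hom K C A A (bar A n.+1) (bar A n) (bar_d A n).
Proof. by split=> *; [exact: gpowd_homL|exact: gpowd_homR]. Qed.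

Lemma bar_dK n X Y f x : bar_d A n X Y f (bar_d A n.+1 X Y f x) = 0.
Proof. exact: gpowdK. Qed.

Lemma hochschild_complex_exists (M : gbimod A A) :
  inhabited (hochschild_complex E M).
Proof.
split; exists (fun n => tensorAe_map E M (bar_d_hom n)) => [*|n].
  exact: tensorAe_mapE.
exact/tensorAe_map_comp0/bar_dK.
Qed.
End HochschildComplex.

(** * Homology of isomorphic complexes *)

Section HomologyMap.
Variables (K : comPzRingType) (C C' : nat -> lmodType K).
Variables (d : forall n, {linear C n.+1 -> C n}).
Variables (d' : forall n, {linear C' n.+1 -> C' n}).
Variable f : forall n, {linear C n -> C' n}.
Hypothesis fd : forall n x, f n (d n x) = d' n (f n.+1 x).

(** In degree 0 both sides vanish, [dout] being the zero map there. *)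
Lemma dout_map n x : f n.-1 (dout d n x) = dout d' n (f n x).
Proof. by case: n x => [|n] x /=; [rewrite linear0|exact: fd]. Qed.

Lemma ker_map_subproof n (z : ker (dout d n)) :
  f n (val z) \in ker_pred (dout d' n).
Proof.
by have := valP z; rewrite !inE -dout_map => /eqP ->; rewrite linear0.
Qed.

Definition ker_map_fun n (z : ker (dout d n)) : ker (dout d' n) :=
  Ker (ker_map_subproof z).

Lemma ker_map_linear n : linear (@ker_map_fun n).
Proof. by move=> a x y; apply: val_inj; rewrite /= !linearP. Qed.
Definition ker_map n : {linear ker (dout d n) -> ker (dout d' n)} :=
  lin (@ker_map_linear n).
Lemma val_ker_map n z : val (ker_map n z) = f n (val z).
Proof. by rewrite linE. Qed.

Lemma homology_map_subproof n (z : ker (dout d n)) :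
  (exists y, val z = d n y) ->
  qproj (fun z => exists y, val z = d' n y) (ker_map n z) = 0.
Proof.
move=> [y zy]; apply: qproj0; exists (f n.+1 y).
by rewrite val_ker_map zy fd.
Qed.
Definition homology_map n : {linear homology d n -> homology d' n} :=
  quot_lift (f := qproj _ \o ker_map n) (@homology_map_subproof n).
Lemma homology_mapE n z : homology_map n (qproj _ z) = qproj _ (ker_map n z).
Proof. by rewrite quot_liftE. Qed.
End HomologyMap.

Lemma homology_map_cancel (K : comPzRingType) (C C' : nat -> lmodType K)
    (d : forall n, {linear C n.+1 -> C n})
    (d' : forall n, {linear C' n.+1 -> C' n})
    (f : forall n, {linear C n -> C' n}) (g : forall n, {linear C' n -> C n})
    (fd : forall n x, f n (d n x) = d' n (f n.+1 x))
    (gd : forall n x, g n (d' n x) = d n (g n.+1 x)) n :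
  cancel (f n) (g n) -> cancel (homology_map fd n) (homology_map gd n).
Proof.
move=> fgK; apply: quot_ind => z; rewrite !homology_mapE; congr (qproj _ _).
by apply: val_inj; rewrite !val_ker_map fgK.
Qed.

(** The inverse of a bijective chain map is again a chain map: [f] is injective and takes both sides
    of [gd] to the same element. *)
Lemma homology_iso (K : comPzRingType) (C C' : nat -> lmodType K)
    (d : forall n, {linear C n.+1 -> C n})
    (d' : forall n, {linear C' n.+1 -> C' n})
    (f : forall n, {linear C n -> C' n}) (g : forall n, {linear C' n -> C n}) :
  (forall n x, f n (d n x) = d' n (f n.+1 x)) ->
  (forall n, cancel (f n) (g n)) -> (forall n, cancel (g n) (f n)) ->
  forall n, lmod_iso (homology d n) (homology d' n).
Proof.
move=> fd fgK gfK n.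
have gd m x : g m (d' m x) = d m (g m.+1 x).
  by apply: (can_inj (fgK m)); rewrite gfK fd gfK.
by exists (homology_map fd n); exists (homology_map gd n);
  apply: homology_map_cancel.
Qed.

(** * Group gradings *)

Section BilinearLifts.
Variables (K : comPzRingType) (C : category).
Unset Implicit Arguments.
Variables (M P : gmod K C) (V : lmodType K).
Set Implicit Arguments.

Section GradedLift.
Variables (X Z : ob C) (k : hom X Z).
Variable b : forall Y (f : hom X Y) (g : hom Y Z), g ∘ f = k ->
  M _ _ f -> P _ _ g -> V.
Hypothesis bl : forall Y (f : hom X Y) (g : hom Y Z) (e : g ∘ f = k) (y : P _ _ g),
  linear (fun x : M _ _ f => b e x y).
Hypothesis br : forall Y (f : hom X Y) (g : hom Y Z) (e : g ∘ f = k) (x : M _ _ f),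
  linear (fun y : P _ _ g => b e x y).

Definition gblift : {linear gtensor M P k -> V} :=
  glift (fun Y f g e => tlift (@bl Y f g e) (@br Y f g e)).
Lemma gbliftE Y (f : hom X Y) (g : hom Y Z) (e : g ∘ f = k) x y :
  gblift (x ⊗[e] y) = b e x y.
Proof. by rewrite [LHS]gliftE tliftE. Qed.
End GradedLift.

Variable b : forall (X Y Z : ob C) (f : hom X Y) (g : hom Y Z),
  M _ _ f -> P _ _ g -> V.
Hypothesis bl : forall (X Y Z : ob C) (f : hom X Y) (g : hom Y Z) (y : P _ _ g),
  linear (fun x : M _ _ f => b x y).
Hypothesis br : forall (X Y Z : ob C) (f : hom X Y) (g : hom Y Z) (x : M _ _ f),
  linear (fun y : P _ _ g => b x y).

Definition gtotlift : {linear gtot (gtensor M P) -> V} :=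
  dlift (fun i : arrow C =>
    gblift (k := amor i) (b := fun Y f g _ => @b _ _ _ f g)
      (fun Y f g _ y => bl y) (fun Y f g _ x => br x)).
Lemma gtotliftE (X Y Z : ob C) (f : hom X Y) (g : hom Y Z) (k : hom X Z)
    (e : g ∘ f = k) (x : M _ _ f) (y : P _ _ g) :
  gtotlift (gin (gtensor M P) k (x ⊗[e] y)) = b x y.
Proof.
pose F := fun i : arrow C => gtensor M P (amor i).
exact: etrans (@dliftE K _ F V _ (Arrow k) _) (gbliftE _ _ _ _ _).
Qed.
End BilinearLifts.

(** Bijectivity provides a mere function as inverse; its linearity comes from that of [dlift f].
    This gives the decomposition into homogeneous parts as a linear map. *)
Lemma dlift_inv (K : comPzRingType) (I : Type) (V : I -> lmodType K) (W : lmodType K)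
    (f : forall i, {linear V i -> W}) :
  bijective (dlift f) ->
  exists g : {linear W -> dsum V}, forall i x, g (f i x) = din V i x.
Proof.
move=> [g fgK gfK].
have gl : linear g by move=> a x y; apply: (can_inj fgK); rewrite linearP !gfK.
by exists (lin gl) => k x; rewrite linE -(dliftE f) fgK.
Qed.

(** * Homogeneous parts of R and N *)

Section GroupGraded.
Variables (K : comPzRingType) (G : groupType) (R : assoc_alg K).
Variables (N : assoc_bimod R) (A : galg (BG1 K G)) (M : gbimod A A).
Variables (i : graded_algebra_by R A) (j : graded_bimodule_by N i M).

Local Notation BGK := (BG1 K G).

(* The object set [unit] has no definitional eta, hence the case distinctions. *)
Definition inA (X Y : ob BGK) : forall f : hom X Y, {linear A X Y f -> R} :=
  match X, Y with tt, tt => ingA i end.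
Definition inM (X Y : ob BGK) : forall f : hom X Y, {linear M X Y f -> N} :=
  match X, Y with tt, tt => ingM j end.

Section Mul.
Variables (X Y Z : ob BGK) (f : hom X Y) (g : hom Y Z) (k : hom X Z).
Hypothesis e : g ∘ f = k.

Lemma inA_mul (x : A _ _ f) (y : A _ _ g) :
  inA _ (gmul A)⟨x ⊗[e] y⟩ = amul R (inA _ x ⊗ inA _ y).
Proof. by case: k / e; case: X Y Z f g x y => -[] [] f' g' x y; apply: ingA_mul. Qed.
Lemma inM_actL (a : A _ _ f) (m : M _ _ g) :
  inM _ (rhoL M)⟨a ⊗[e] m⟩ = actL N (inA _ a ⊗ inM _ m).
Proof. by case: k / e; case: X Y Z f g a m => -[] [] f' g' a m; apply: ingM_actL. Qed.
Lemma inM_actR (m : M _ _ f) (a : A _ _ g) :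
  inM _ (rhoR M)⟨m ⊗[e] a⟩ = actR N (inM _ m ⊗ inA _ a).
Proof. by case: k / e; case: X Y Z f g a m => -[] [] f' g' a m; apply: ingM_actR. Qed.
End Mul.

Lemma inA_one X : inA _ (gone A X) = aone R.
Proof. by case: X; apply: ingA_one. Qed.

Lemma graded_alg_ind (P : R -> Prop) :
  P 0 -> (forall x y, P x -> P y -> P (x + y)) ->
  (forall (g : G) (x : A tt tt g), P (ingA i g x)) -> forall x, P x.
Proof.
move=> P0 PD Pp x; have [h _ hK] := ingA_dsum i; rewrite -(hK x).
elim/dsum_ind: (h x) => [|y z|g y]; first by rewrite linear0.
- by rewrite linearD; apply: PD.
- by rewrite dliftE.
Qed.

Lemma graded_bimod_ind (P : N -> Prop) :
  P 0 -> (forall x y, P x -> P y -> P (x + y)) ->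
  (forall (g : G) (x : M tt tt g), P (ingM j g x)) -> forall x, P x.
Proof.
move=> P0 PD Pp x; have [h _ hK] := ingM_dsum j; rewrite -(hK x).
elim/dsum_ind: (h x) => [|y z|g y]; first by rewrite linear0.
- by rewrite linearD; apply: PD.
- by rewrite dliftE.
Qed.

Lemma comp_eq0 (U V V' W : lmodType K) (p : {linear V -> W}) (q : {linear U -> V})
    (p' : {linear V' -> W}) (q' : {linear U -> V'}) :
  p (q 0) = p' (q' 0).
Proof. by rewrite !linear0. Qed.

Lemma comp_eqD (U V V' W : lmodType K) (p : {linear V -> W}) (q : {linear U -> V})
    (p' : {linear V' -> W}) (q' : {linear U -> V'}) x y :
  p (q x) = p' (q' x) -> p (q y) = p' (q' y) -> p (q (x + y)) = p' (q' (x + y)).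
Proof. by move=> hx hy; rewrite !linearD hx hy. Qed.

(** * Contracting bar chains into N *)

Section Contraction.
Lemma actR_linear (X Y : ob BGK) (f : hom X Y) (m : N) :
  linear (fun x : A _ _ f => actR N (m ⊗ inA f x)).
Proof. by move=> a x y; rewrite linearP tpure_linr linearP. Qed.

(* [absorb n f m] is the map [a_0 ⊗ ... ⊗ a_n |-> m a_0 ⊗ a_1 ⊗ ... ⊗ a_n]. *)
Fixpoint absorb n : forall X Y (f : hom X Y), N -> {linear gpow A n f -> hpow N n} :=
  match n return forall X Y (f : hom X Y), N -> {linear gpow A n f -> hpow N n} with
  | 0 => fun X Y f m => lin (@actR_linear X Y f m)
  | n'.+1 => fun X Y f m => glift (fun Z (g : hom X Z) (h : hom Z Y) _ =>
      tmap (absorb n' g m) (inA h))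
  end.

Lemma absorb0 X Y (f : hom X Y) m (x : A _ _ f) :
  @absorb 0 X Y f m x = actR N (m ⊗ inA f x).
Proof. exact: linE. Qed.

Lemma absorbS n X Y Z (f : hom X Y) (g : hom Y Z) (k : hom X Z) (e : g ∘ f = k) m
    (t : gpow A n f) (x : A _ _ g) :
  @absorb n.+1 X Z k m (t ⊗[e] x) = @absorb n X Y f m t ⊗ inA g x.
Proof. by rewrite [LHS]gliftE tliftE. Qed.

Lemma absorb_linear n X Y (f : hom X Y) (t : gpow A n f) :
  linear (fun m => @absorb n X Y f m t).
Proof.
move=> a m m'; elim: n X Y f t => [|n IH] X Y f t.
  by rewrite !absorb0 tpure_linl linearP.
elim/gpow_ind: t => [|t t' ht ht'|Z g h e t x].
- by rewrite !linear0 addr0.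
- by rewrite !linearD ht ht' addrACA.
- by rewrite !absorbS IH tpure_linl.
Qed.

Lemma BG1_inv (X Y Z W : ob BGK) (f : hom X Y) (g : hom Y Z) (h : hom Z W) :
  uinv (alpha BGK f g h) = 1.
Proof. by []. Qed.
Lemma BG1_val (X Y Z W : ob BGK) (f : hom X Y) (g : hom Y Z) (h : hom Z W) :
  uval (alpha BGK f g h) = 1.
Proof. by []. Qed.

(** The left action changes only a_0, and m (a a_0) = (m a) a_0. This is the balancing that makes
    [absorb] a map out of N ⊗_R R^{⊗ n+1}. *)
Lemma absorbL n X Y Z (f : hom X Y) (g : hom Y Z) (k : hom X Z) (e : g ∘ f = k) m
    (a : A _ _ f) (t : gpow A n g) :
  @absorb n X Z k m (gpowL A n k (a ⊗[e] t)) =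
  @absorb n Y Z g (actR N (m ⊗ inA f a)) t.
Proof.
elim: n Z g k e t => [|n IH] Z g k e t.
  by rewrite gpowL0 !absorb0 inA_mul actRA.
elim/gpow_ind: t => [|t t' ht ht'|W u v e' t x].
- by rewrite gpure0r !linear0.
- by rewrite gpureDr !linearD ht ht'.
have e1 : v ∘ (u ∘ f) = k by rewrite compA e'.
by rewrite (gpowLE (erefl _) e1) BG1_inv scale1r !absorbS IH.
Qed.

(** The right action changes only the last factor. For n = 0 that factor is a_0, already absorbed
    into [m], hence the case distinction. *)
Lemma absorbR n X Y Z (f : hom X Y) (g : hom Y Z) (k : hom X Z) (e : g ∘ f = k) m
    (t : gpow A n f) (a : A _ _ g) :
  @absorb n X Z k m (gpowR A n k (t ⊗[e] a)) =
  hpowR N n (@absorb n X Y f m t ⊗ inA g a).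
Proof.
case: n t => [|n] t.
  by rewrite gpowR0 !absorb0 inA_mul actRA.
elim/gpow_ind: t => [|t t' ht ht'|W u v e' t x].
- by rewrite gpure0l !linear0 -(linE (tpure_linl _)) !linear0.
- by rewrite gpureDl !linearD ht ht' tpureDl linearD.
have e1 : (g ∘ v) ∘ u = k by rewrite -compA e'.
rewrite (gpowRE _ _ (erefl _) e1) BG1_val scale1r !absorbS inA_mul.
by rewrite /= tassocE tliftE.
Qed.

Lemma hpowL_absorb n X Y (f : hom X Y) m r (t : gpow A n f) :
  hpowL N r n (@absorb n X Y f m t) = @absorb n X Y f (actL N (r ⊗ m)) t.
Proof.
elim: n X Y f t => [|n IH] X Y f t.
  by rewrite !absorb0 /= linE actLRA.
elim/gpow_ind: t => [|t t' ht ht'|Z g h e t x].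
- by rewrite !linear0.
- by rewrite !linearD ht ht'.
- by rewrite !absorbS -IH /= tliftE.
Qed.

(** The face a_0 a_1 of the bar complex becomes the face (m a_0) a_1 of the classical one, and the
    remaining bar faces become the other noncyclic faces. *)
Lemma hpow_inner_absorb n X Y (f : hom X Y) m (t : gpow A n.+1 f) :
  hpow_inner N n (@absorb n.+1 X Y f m t) = @absorb n X Y f m (gpowd A n f t).
Proof.
elim: n X Y f t => [|n IH] X Y f t; elim/gpow_ind: t => [|t t' ht ht'|Z g h e t x].
- exact: comp_eq0.
- exact: comp_eqD.
- by rewrite absorbS gpowd0 !absorb0 inA_mul actRA.
- exact: comp_eq0.
- exact: comp_eqD.
rewrite gpowdE linearD linearZ_LR absorbR !absorbS -IH.
by rewrite [LHS]/= tliftE.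
Qed.
End Contraction.
End GroupGraded.

Section Comparison.
Variables (K : comPzRingType) (G : groupType) (R : assoc_alg K).
Variables (N : assoc_bimod R) (A : galg (BG1 K G)) (M : gbimod A A).
Variables (i : graded_algebra_by R A) (j : graded_bimodule_by N i M).

Local Notation BGK := (BG1 K G).

(** * The map to the classical complex *)

Section ToClassical.
Variable n : nat.

Lemma fold_linl (X Y Z : ob BGK) (g : hom X Z) (h : hom Z Y) (m : N) (x : A _ _ h) :
  linear (fun t : gpow A n g => absorb i n g (actL N (inA i h x ⊗ m)) t).
Proof. exact: linearP. Qed.
Lemma fold_linr (X Y Z : ob BGK) (g : hom X Z) (h : hom Z Y)
    (m : N) (t : gpow A n g) :
  linear (fun x : A _ _ h => absorb i n g (actL N (inA i h x ⊗ m)) t).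
Proof.
by move=> a x y; rewrite linearP tpure_linl linearP absorb_linear.
Qed.

(** With [m] fixed, this is a_0 ⊗ ... ⊗ a_{n+1} |-> a_{n+1} m a_0 ⊗ a_1 ⊗ ... ⊗ a_n: the last factor
    acts on [m] and [absorb] handles the rest. *)
Definition fold (X Y : ob BGK) (f : hom X Y) (m : N) :
    {linear gpow A n.+1 f -> hpow N n} :=
  gblift (M := gpow A n) (P := A) (k := f)
    (fun Z g h _ x => @fold_linl X Y Z g h m x)
    (fun Z g h _ t => @fold_linr X Y Z g h m t).

Lemma foldE (X Y Z : ob BGK) (g : hom X Z) (h : hom Z Y) (f : hom X Y)
    (e : h ∘ g = f) m (t : gpow A n g) (x : A _ _ h) :
  fold f m (t ⊗[e] x) = absorb i n g (actL N (inA i h x ⊗ m)) t.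
Proof. exact: gbliftE. Qed.

Lemma fold_linear (X Y : ob BGK) (f : hom X Y) (s : gpow A n.+1 f) :
  linear (fun m => fold f m s).
Proof.
move=> a m m'; elim/gpow_ind: s => [|s s' hs hs'|Z g h e t x].
- by rewrite !linear0 addr0.
- by rewrite !linearD hs hs' addrACA.
- by rewrite !foldE tpure_linr linearP absorb_linear.
Qed.

Lemma fold_tot_linl (X Y Z : ob BGK) (f : hom X Y)
    (g : hom Y Z) (s : gpow A n.+1 g) :
  linear (fun m : M _ _ f => fold g (inM j f m) s).
Proof. by move=> a m m'; rewrite linearP fold_linear. Qed.
Lemma fold_tot_linr (X Y Z : ob BGK) (f : hom X Y) (g : hom Y Z) (m : M _ _ f) :
  linear (fun s : gpow A n.+1 g => fold g (inM j f m) s).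
Proof. exact: linearP. Qed.

Definition fold_tot : {linear gtot (gtensor M (bar A n)) -> hpow N n} :=
  gtotlift (P := gpow A n.+1) fold_tot_linl fold_tot_linr.

Lemma fold_totE (X Y Z : ob BGK) (f : hom X Y) (g : hom Y Z) (k : hom X Z)
    (e : g ∘ f = k) (m : M _ _ f) (s : gpow A n.+1 g) :
  fold_tot (gin (gtensor M (gpow A n.+1)) k (m ⊗[e] s)) = fold g (inM j f m) s.
Proof. exact: gtotliftE. Qed.

(** The outer actions meet only the first and last factors, which [fold] multiplies into [m] anyway;
    this is the defining relation of the tensor product over A ⊗ A^op. *)
Lemma fold_bimod (X Y Z W : ob BGK) (f : hom X Y) (g : hom Y Z) (h : hom Z W)
    (fg : hom X Z) (k : hom X W) (e1 : g ∘ f = fg) (e2 : h ∘ fg = k)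
    (a : A _ _ f) (s : gpow A n.+1 g) (a' : A _ _ h) m :
  fold k m (gpowR A n.+1 k (gpowL A n.+1 fg (a ⊗[e1] s) ⊗[e2] a')) =
  fold g (actL N (inA i h a' ⊗ actR N (m ⊗ inA i f a))) s.
Proof.
elim/gpow_ind: s => [|s s' hs hs'|V u v e t x].
- by rewrite gpure0r linear0 gpure0l !linear0.
- by rewrite gpureDr linearD gpureDl !linearD hs hs'.
have e3 : v ∘ (u ∘ f) = fg by rewrite compA e.
have e4 : (h ∘ v) ∘ (u ∘ f) = k by rewrite -compA e3.
rewrite (gpowLE (erefl _) e3) BG1_inv scale1r (gpowRE _ _ (erefl _) e4).
by rewrite BG1_val scale1r !foldE absorbL inA_mul actLRA actLA.
Qed.

Lemma theta_BG1 (X Y Z W : ob BGK) (f : hom X Y) (h : hom Y Z) (g : hom Z W)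
    (h' : hom W X) : theta (BG11 K G) f h g h' = 1.
Proof. by rewrite /theta /= !mulr1. Qed.

Lemma fold_tot_rel x : hochschild_rel (BG11 K G) (M := M) (N := bar A n) x ->
  fold_tot x = 0.
Proof.
(* All objects of [BG] coincide, so that the two kinds of relations with degrees not closing up to a
   loop are vacuous. *)
case=> [X Y Z W f h g h' m a s a'|[] [] Y Z [] f h g h' m a s a' []//
       |[] [] Y Z W f h g h' m a s a' []//].
rewrite linearB linearZ_LR theta_BG1 scale1r !fold_totE fold_bimod.
by rewrite inM_actL inM_actR subrr.
Qed.

Definition to_classical : {linear tensorAe (BG11 K G) M (bar A n) -> hpow N n} :=
  quot_lift fold_tot_rel.

Lemma to_classicalE (X Y Z : ob BGK) (f : hom X Y) (g : hom Y Z) (m : M _ _ f)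
    (s : bar A n _ _ g) :
  to_classical (tensorAe_pure (BG11 K G) m s) = fold g (inM j f m) s.
Proof. by rewrite quot_liftE fold_totE. Qed.
End ToClassical.

(** With ∂(t ⊗ x) = ∂t ⊗ x ± t · x, the first summand yields the noncyclic faces. In the second the
    last two factors [y] and [x] are multiplied, and (y x) m = y (x m) identifies it with the cyclic
    face, with the same sign. *)
Lemma fold_d n (X Y : ob BGK) (f : hom X Y) m (s : gpow A n.+2 f) :
  fold n f m (gpowd A n.+1 f s) = hochschild_d N n (fold n.+1 f m s).
Proof.
elim/gpow_ind: s => [|s s' hs hs'|Z g h e t x].
- exact: comp_eq0.
- exact: comp_eqD.
rewrite gpowdE linearD linearZ_LR !foldE [RHS]/= hpow_inner_absorb.
congr (_ + _ *: _).
move: t; elim/gpow_ind => [|t t' ht ht'|V u v e' t y].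
- by rewrite gpure0l !linear0.
- by rewrite gpureDl !linearD ht ht'.
have e1 : (h ∘ v) ∘ u = f by rewrite -compA e'.
rewrite (gpowRE _ _ (erefl _) e1) BG1_val scale1r foldE absorbS inA_mul actLA.
by rewrite /hpow_cyc tliftE hpowL_absorb.
Qed.

(** * The map from the classical complex *)

Lemma gin_pure_linl (C : category) (P Q : gmod K C) (X Y Z : ob C) (f : hom X Y)
    (g : hom Y Z) (k : hom X Z) (e : g ∘ f = k) (y : Q _ _ g) :
  linear (fun x : P _ _ f => gin (gtensor P Q) k (x ⊗[e] y)).
Proof. by move=> a x x'; rewrite gpure_linl linearP. Qed.
Lemma gin_pure_linr (C : category) (P Q : gmod K C) (X Y Z : ob C) (f : hom X Y)
    (g : hom Y Z) (k : hom X Z) (e : g ∘ f = k) (x : P _ _ f) :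
  linear (fun y : Q _ _ g => gin (gtensor P Q) k (x ⊗[e] y)).
Proof. by move=> a y y'; rewrite gpure_linr linearP. Qed.

Lemma lin_combo0 (U W : lmodType K) a (p q r : {linear U -> W}) :
  p 0 = a *: q 0 + r 0.
Proof. by rewrite !linear0 addr0. Qed.
Lemma lin_comboD (U W : lmodType K) a (p q r : {linear U -> W}) x y :
  p x = a *: q x + r x -> p y = a *: q y + r y ->
  p (x + y) = a *: q (x + y) + r (x + y).
Proof. by move=> hx hy; rewrite !linearD hx hy addrACA. Qed.

Lemma gtot_gtensor_ind (C : category) (P Q : gmod K C)
    (F : gtot (gtensor P Q) -> Prop) :
  F 0 -> (forall x y, F x -> F y -> F (x + y)) ->
  (forall (X Y Z : ob C) (f : hom X Y) (g : hom Y Z) x y,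
     F (gin (gtensor P Q) (g ∘ f) (x ⊗[erefl _] y))) -> forall x, F x.
Proof.
move=> F0 FD Fp; apply: gtot_ind => [||X Z k] //.
apply: gtensor_ind => [|x y Fx Fy|Y f g e x y]; first by rewrite linear0.
  by rewrite linearD; apply: FD.
by case: k / e; apply: Fp.
Qed.

(* Maps out of [R] and [N] are built on the direct sums, through the inverses
   of the decompositions into homogeneous parts. *)
Section FromClassical.
Variables (decR : {linear R -> dsum (fun g : G => A tt tt g)}).
Hypothesis decRE : forall (g : G) x, decR (ingA i g x) = din _ g x.
Variables (decN : {linear N -> dsum (fun g : G => M tt tt g)}).
Hypothesis decNE : forall (g : G) x, decN (ingM j g x) = din _ g x.

(** A variable [Z] is not convertible with [tt], whereas the homogeneous parts of [R] are indexed
    over [tt] alone. *)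
Definition to_src (Z : ob BGK) (h : G) : A tt tt h -> A Z tt h :=
  match Z with tt => id end.
Lemma to_src_linear Z h : linear (@to_src Z h).
Proof. by case: Z. Qed.

Section Append.
Unset Implicit Arguments.
Variable P : gmod K BGK.
Set Implicit Arguments.

(** Homogeneous case of [append]; it is extended linearly in the chain, then in the element of the
    direct sum, and transported to [R] by [decR]. *)
Definition append_src (h : G) (x : A tt tt h) (X Y Z : ob BGK) (f : hom X Y)
    (g : hom Y Z) (m : M _ _ f) (t : P _ _ g) : gtot (gtensor M (gtensor P A)) :=
  gin (gtensor M (gtensor P A)) (((h : @hom BGK Z tt) ∘ g) ∘ f)
    (m ⊗[erefl _] (t ⊗[erefl ((h : @hom BGK Z tt) ∘ g)] to_src Z x)).

Lemma append_src_linl h x X Y Z (f : hom X Y) (g : hom Y Z) t :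
  linear (fun m => @append_src h x X Y Z f g m t).
Proof. exact: gin_pure_linl. Qed.
Lemma append_src_linr h x X Y Z (f : hom X Y) (g : hom Y Z) m :
  linear (fun t => @append_src h x X Y Z f g m t).
Proof.
by move=> a t t'; rewrite /append_src gpure_linl gin_pure_linr.
Qed.
Definition append_hom h (x : A tt tt h) :
    {linear gtot (gtensor M P) -> gtot (gtensor M (gtensor P A))} :=
  gtotlift (@append_src_linl h x) (@append_src_linr h x).

Lemma append_homE h (x : A tt tt h) (X Y Z : ob BGK) (f : hom X Y) (g : hom Y Z)
    (k : hom X Z) (e : g ∘ f = k) m t :
  append_hom x (gin (gtensor M P) k (m ⊗[e] t)) = @append_src h x X Y Z f g m t.
Proof. exact: gtotliftE. Qed.

Lemma append_hom_linear h y : linear (fun x : A tt tt h => append_hom x y).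
Proof.
move=> a x x'; elim/gtot_gtensor_ind: y => [|y y' hy hy'|X Y Z f g m t].
- exact: lin_combo0.
- exact: lin_comboD.
by rewrite !append_homE /append_src to_src_linear gpure_linr gin_pure_linr.
Qed.

Definition append_dec y : {linear dsum (fun g : G => A tt tt g) ->
    gtot (gtensor M (gtensor P A))} :=
  dlift (fun h : G => lin (@append_hom_linear h y)).

Lemma append_dec_linear r : linear (fun y => append_dec y r).
Proof.
move=> a y y'; elim/dsum_ind: r => [|r r' hr hr'|h x].
- exact: lin_combo0.
- exact: lin_comboD.
- by rewrite !dliftE !(linE (@append_hom_linear h _)) linearP.
Qed.

(* [append r] maps [m ⊗ t] to [m ⊗ (t ⊗ r)]. *)
Definition append (r : R) :
    {linear gtot (gtensor M P) -> gtot (gtensor M (gtensor P A))} :=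
  lin (append_dec_linear (decR r)).

Lemma append_linear y : linear (fun r => append r y).
Proof.
by move=> a r r'; rewrite /append !(linE (@append_dec_linear _)) !linearP.
Qed.

Lemma append0 y : append 0 y = 0.
Proof. by rewrite -(linE (append_linear y)) linear0. Qed.
Lemma appendD r r' y : append (r + r') y = append r y + append r' y.
Proof. by rewrite -!(linE (append_linear y)) linearD. Qed.

Lemma appendE (X Y Z W : ob BGK) (f : hom X Y) (g : hom Y Z) (h : hom Z W)
    (gf : hom X Z) (hg : hom Y W) (k : hom X W)
    (e1 : g ∘ f = gf) (e2 : h ∘ g = hg) (e3 : hg ∘ f = k)
    (m : M _ _ f) (t : P _ _ g) (x : A _ _ h) :
  append (inA i h x) (gin (gtensor M P) gf (m ⊗[e1] t)) =
  gin (gtensor M (gtensor P A)) k (m ⊗[e3] (t ⊗[e2] x)).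
Proof.
case: k / e3; case: hg / e2; case: Z W g h gf e1 t x => -[] g h gf e1 t x.
rewrite /append (linE (@append_dec_linear _)) decRE.
by rewrite [append_dec _ _]dliftE (linE (@append_hom_linear h _)) append_homE.
Qed.
End Append.

Lemma insert_one0_linear (g : G) : linear (fun m : M tt tt g =>
  gin (gtensor M A) (g : @hom BGK tt tt) (m ⊗[comp_idl _] gone A tt)).
Proof. exact: gin_pure_linl. Qed.

Definition insert_one0 : {linear N -> gtot (gtensor M (gpow A 0))} :=
  dlift (fun g : G => lin (@insert_one0_linear g)) \o decN.

Lemma insert_one0E (X Y : ob BGK) (f : hom X Y) (m : M _ _ f) :
  insert_one0 (inM j f m) =
  gin (gtensor M (gpow A 0)) f (m ⊗[comp_idl f] gone A Y).
Proof.
by case: X Y f m => -[] f m; rewrite /insert_one0 /= decNE dliftE linE.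
Qed.

Lemma insert_one_linr (P : lmodType K) (Q : gmod K BGK)
    (p : {linear P -> gtot (gtensor M Q)}) s :
  linear (fun r => append Q r (p s)).
Proof. exact: append_linear. Qed.
Lemma insert_one_linl (P : lmodType K) (Q : gmod K BGK)
    (p : {linear P -> gtot (gtensor M Q)}) r :
  linear (fun s => append Q r (p s)).
Proof. by move=> a s s'; rewrite !linearP. Qed.

(* [insert_one n] maps [m ⊗ a_1 ⊗ ... ⊗ a_n] to [m ⊗ (1 ⊗ a_1 ⊗ ... ⊗ a_n)]. *)
Fixpoint insert_one n : {linear hpow N n -> gtot (gtensor M (gpow A n))} :=
  match n return {linear hpow N n -> gtot (gtensor M (gpow A n))} with
  | 0 => insert_one0
  | n'.+1 =>
      tlift (insert_one_linl (insert_one n')) (insert_one_linr (insert_one n'))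
  end.

Lemma insert_oneS n s r : insert_one n.+1 (s ⊗ r) =
  append (gpow A n) r (insert_one n s).
Proof. exact: tliftE. Qed.

Lemma absorb_tot_linl n (X Y Z : ob BGK) (f : hom X Y)
    (g : hom Y Z) (t : gpow A n g) :
  linear (fun m : M _ _ f => absorb i n g (inM j f m) t).
Proof. by move=> a m m'; rewrite linearP absorb_linear. Qed.
Lemma absorb_tot_linr n (X Y Z : ob BGK) (f : hom X Y) (g : hom Y Z) (m : M _ _ f) :
  linear (fun t : gpow A n g => absorb i n g (inM j f m) t).
Proof. exact: linearP. Qed.
Definition absorb_tot n : {linear gtot (gtensor M (gpow A n)) -> hpow N n} :=
  gtotlift (@absorb_tot_linl n) (@absorb_tot_linr n).
Lemma absorb_totE n (X Y Z : ob BGK) (f : hom X Y) (g : hom Y Z) (k : hom X Z)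
    (e : g ∘ f = k) (m : M _ _ f) (t : gpow A n g) :
  absorb_tot n (gin (gtensor M (gpow A n)) k (m ⊗[e] t)) =
  absorb i n g (inM j f m) t.
Proof. exact: gtotliftE. Qed.

Lemma absorb_tot_append n r y :
  absorb_tot n.+1 (append (gpow A n) r y) = absorb_tot n y ⊗ r.
Proof.
elim/(graded_alg_ind (i := i)): r => [|r r' hr hr'|h x].
- by rewrite append0 linear0 -(linE (tpure_linr (absorb_tot n y))) linear0.
- by rewrite appendD linearD hr hr' -!(linE (tpure_linr (absorb_tot n y))) linearD.
elim/gtot_gtensor_ind: y => [|y y' hy hy'|X Y [] f g m t].
- by rewrite !linear0 -(linE (tpure_linl (ingA i h x))) linear0.
- by rewrite !linearD hy hy' tpureDl.
rewrite (@appendE (gpow A n) _ _ tt tt _ _ h _ _ _ _ (erefl _) (erefl _)).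
by rewrite !absorb_totE absorbS.
Qed.

(** In degree 0 this is m 1 = m; afterwards every appended factor is read off unchanged by
    [absorb_tot]. *)
Lemma insert_oneK n s : absorb_tot n (insert_one n s) = s.
Proof.
elim: n s => [|n IH] s.
  elim/(graded_bimod_ind (j := j)): s => [|s s' hs hs'|g m].
  - by rewrite !linear0.
  - by rewrite !linearD hs hs'.
  by rewrite [insert_one _ _](@insert_one0E tt tt) absorb_totE absorb0 inA_one actR1.
elim/tensor_ind: s => [|s s' hs hs'|s r].
- by rewrite !linear0.
- by rewrite !linearD hs hs'.
by rewrite insert_oneS absorb_tot_append IH.
Qed.

Lemma fold_tot_append1 n y :
  fold_tot n (append (gpow A n) (aone R) y) = absorb_tot n y.
Proof.
elim/gtot_gtensor_ind: y => [|y y' hy hy'|X Y Z f g m t].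
- by rewrite !linear0.
- by rewrite !linearD hy hy'.
rewrite -(inA_one i Z) (@appendE _ _ _ _ _ _ _ _ _ _ _ _ (erefl _) (erefl _)).
by rewrite fold_totE foldE absorb_totE inA_one actL1.
Qed.

(* The relation of [M ⊗_A A^{⊗ n+1}]: it moves [a_0] into [m] whatever follows,
   so that it is stable under [append]. *)
Definition balanced n (W : lmodType K) (F : gtot (gtensor M (gpow A n)) -> W) :=
  forall (X Y Z V : ob BGK) (f : hom X Y) (g : hom Y Z) (h : hom Z V)
    (gf : hom X Z) (hg : hom Y V) (k : hom X V) (e1 : g ∘ f = gf)
    (e2 : h ∘ gf = k) (e3 : h ∘ g = hg) (e4 : hg ∘ f = k)
    (m : M _ _ f) (a : A _ _ g) (t : gpow A n h),
  F (gin (gtensor M (gpow A n)) k ((rhoR M)⟨m ⊗[e1] a⟩ ⊗[e2] t)) =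
  F (gin (gtensor M (gpow A n)) k (m ⊗[e4] (gpowL A n)⟨a ⊗[e3] t⟩)).

Lemma balanced_append n (W : lmodType K)
    (F : {linear gtot (gtensor M (gpow A n.+1)) -> W}) r :
  balanced F -> balanced (F \o append (gpow A n) r).
Proof.
move=> Fb X Y Z V f g h gf hg k e1 e2 e3 e4 m a t /=.
elim/(graded_alg_ind (i := i)): r => [|r r' hr hr'|u x].
- by rewrite !append0.
- by rewrite !appendD !linearD hr hr'.
case: V h t hg k e2 e3 e4 => h t hg k e2 e3 e4.
pose u' : @hom BGK tt tt := u.
have e5 : (u' ∘ h) ∘ g = u' ∘ hg by rewrite -compA e3.
have e6 : (u' ∘ h) ∘ gf = u' ∘ k by rewrite -compA e2.
have e7 : (u' ∘ hg) ∘ f = u' ∘ k by rewrite -compA e4.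
rewrite (@appendE (gpow A n) _ _ tt tt _ _ u' _ _ _ _ (erefl _) e6).
rewrite (@appendE (gpow A n) _ _ tt tt _ _ u' _ _ _ _ (erefl _) e7).
rewrite (Fb _ _ _ _ _ _ _ _ _ _ e1 e6 e5 e7).
by rewrite (gpowLE e3 (erefl _)) BG1_inv scale1r.
Qed.

(** Modulo the balancing relation, m a_0 ⊗ (1 ⊗ a_1 ⊗ ... ⊗ a_n) equals m ⊗ (a_0 ⊗ ... ⊗ a_n). [F]
    is generalized because the induction step strips the last factor by passing to the composite of
    [F] with [append]. *)
Lemma insert_one_absorb n (W : lmodType K)
    (F : {linear gtot (gtensor M (gpow A n)) -> W}) :
  balanced F ->
  forall (X Y Z : ob BGK) (f : hom X Y) (g : hom Y Z) (k : hom X Z)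
    (e : g ∘ f = k) (m : M _ _ f) (t : gpow A n g),
  F (insert_one n (absorb i n g (inM j f m) t)) =
  F (gin (gtensor M (gpow A n)) k (m ⊗[e] t)).
Proof.
elim: n W F => [|n IH] W F Fb X Y Z f g k e m t.
  rewrite absorb0 -(inM_actR _ e) [insert_one _ _]insert_one0E.
  (* The element m a_0 ⊗ 1 is balanced against m ⊗ a_0 1, and the unit law applies. *)
  rewrite (Fb _ _ _ _ _ _ _ _ _ _ _ _ (comp_idl g) e) gpowL0 gmul1r.
  by rewrite BG1_val scale1r.
elim/gpow_ind: t => [|t t' ht ht'|V u v e' t x].
- by rewrite gpure0r !linear0.
- by rewrite gpureDr !linearD ht ht'.
rewrite absorbS insert_oneS.
have e1 : v ∘ (u ∘ f) = k by rewrite compA e'.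
have Fxb := balanced_append (inA i v x) Fb.
apply: etrans (IH _ (F \o append _ _) Fxb _ _ _ _ _ _ (erefl (u ∘ f)) m t) _.
by rewrite /= (appendE _ e' e).
Qed.

(** * The two maps are mutually inverse *)

Definition of_classical n : {linear hpow N n -> tensorAe (BG11 K G) M (bar A n)} :=
  qproj _ \o (append (gpow A n) (aone R) \o insert_one n).

Lemma of_classicalK n : cancel (of_classical n) (to_classical n).
Proof. by move=> s; rewrite quot_liftE fold_tot_append1 insert_oneK. Qed.

Lemma qproj_gin n (X Y Z : ob BGK) (f : hom X Y) (g : hom Y Z) (k : hom X Z)
    (e : g ∘ f = k) (m : M _ _ f) (s : bar A n _ _ g) :
  qproj (hochschild_rel (BG11 K G) (M := M) (N := bar A n))
    (gin (gtensor M (bar A n)) k (m ⊗[e] s)) =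
  tensorAe_pure (BG11 K G) m s.
Proof. by case: k / e. Qed.

Lemma tensorAe_rel n (X Y Z W : ob BGK) (f : hom X Y) (h : hom Y Z) (g : hom Z W)
    (h' : hom W X) (hf : hom X Z) (k : hom W Z) (gh : hom Y W) (k' : hom Y X)
    (e1 : h ∘ f = hf) (e2 : hf ∘ h' = k) (e3 : g ∘ h = gh) (e4 : h' ∘ gh = k')
    (m : M _ _ f) (a : A _ _ h) (s : bar A n _ _ g) (a' : A _ _ h') :
  tensorAe_pure (BG11 K G) (rhoL M)⟨a' ⊗[e2] (rhoR M)⟨m ⊗[e1] a⟩⟩ s =
  tensorAe_pure (BG11 K G) m
    (rhoR (bar A n))⟨(rhoL (bar A n))⟨a ⊗[e3] s⟩ ⊗[e4] a'⟩.
Proof.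
case: k / e2; case: hf / e1; case: k' / e4; case: gh / e3.
have := qproj0 (hrel_loop (BG11 K G) (N := bar A n) m a s a').
by rewrite theta_BG1 scale1r linearB => /subr0_eq.
Qed.

(** Take a' = 1 in the relation over A ⊗ A^op; the unit disappears by the unit laws of [M] and of
    the bar term. *)
Lemma balanced_qproj n :
  balanced (n := n.+1) (qproj (hochschild_rel (BG11 K G) (M := M) (N := bar A n))).
Proof.
move=> [] Y Z [] f g h gf hg k e1 e2 e3 e4 m a t.
apply: etrans (qproj_gin e2 _ _) _; apply: etrans _ (esym (qproj_gin e4 _ _)).
have := tensorAe_rel (n := n) e1 (comp_idr gf) e3 (comp_idl hg) m a t (gone A tt).
rewrite (rhoL1 (gbimodP M)) BG1_inv scale1r => ->.
congr tensorAe_pure.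
by rewrite [LHS](rhoR1 (gpow_bimod A n.+1)) BG1_val scale1r.
Qed.

Lemma to_classicalK n : cancel (to_classical n) (of_classical n).
Proof.
move=> x; elim/tensorAe_ind: x => [|x y hx hy|[] [] [] f g m s].
- by rewrite !linear0.
- by rewrite !linearD hx hy.
rewrite to_classicalE /tensorAe_pure /htensor.
elim/gpow_ind: s => [|s s' hs hs'|[] g' h e t x].
- by rewrite gpure0r !linear0.
- by rewrite gpureDr !linearD hs hs'.
rewrite foldE -(inM_actL _ (erefl _)).
(* By balancing, the image of m ⊗ (t ⊗ x) under the composite is the class of x m ⊗ (t ⊗ 1). *)
have Fb := balanced_append (aone R) (@balanced_qproj n).
apply: etrans (insert_one_absorb (F := _ \o append _ _) Fb (erefl _) _ _) _.
rewrite /= -(inA_one i tt) (appendE _ (comp_idl g') (erefl _)).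
apply: etrans (qproj_gin _ _ _) _; apply: etrans _ (esym (qproj_gin _ _ _)).
(* The relation with a = 1 and a' = x moves [x] back from [m] to the last factor, where 1 x = x. *)
have := tensorAe_rel (n := n) (comp_idl f) (erefl (f ∘ h)) (comp_idr g') e m
  (gone A tt) (t ⊗[comp_idl g'] gone A tt) x.
rewrite (rhoR1 (gbimodP M)) BG1_val scale1r => ->.
congr tensorAe_pure.
rewrite (rhoL1 (gpow_bimod A n.+1)) BG1_inv scale1r.
rewrite [LHS](gpowRE _ _ (comp_idr h) e) gmul1l BG1_val BG1_inv.
by rewrite !scale1r.
Qed.
End FromClassical.

(** The choice of [D] is immaterial: [hhdE] determines its differential on pure tensors, which
    generate. *)
Lemma group_graded_HH (D : hochschild_complex (BG11 K G) M) n :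
  lmod_iso (graded_HH D n) (HH N n).
Proof.
have [decR decRE] := dlift_inv (ingA_dsum i).
have [decN decNE] := dlift_inv (ingM_dsum j).
apply: (homology_iso (f := to_classical) (g := of_classical decR decN)) => {n} n.
- move=> x; elim/tensorAe_ind: x => [|x y|X Y Z f g m s].
  + exact: comp_eq0.
  + exact: comp_eqD.
  by rewrite hhdE !to_classicalE; apply: fold_d.
- exact: to_classicalK.
- exact: of_classicalK.
Qed.
End Comparison.

Theorem theorem1p1 (K : comPzRingType) :
  (forall (C : grading_category K) (E : looper C) (A : galg C)
      (M : gbimod A A),
    [/\ forall n, is_gbimod (bar A n),
        forall n, @is_gbimod_hom K C A A (bar A n.+1) (bar A n) (bar_d A n),
        forall n X Y f x, bar_d A n X Y f (bar_d A n.+1 X Y f x) = 0%R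
      & inhabited (hochschild_complex E M)]) /\
  (forall (G : groupType) (R : assoc_alg K) (N : assoc_bimod R)
      (A : galg (BG1 K G)) (M : gbimod A A)
      (i : graded_algebra_by R A) (j : graded_bimodule_by N i M)
      (D : hochschild_complex (BG11 K G) M) (n : nat),
    lmod_iso (graded_HH D n) (HH N n)).
Proof.
split=> [C E A M|G R N A M i j D n]; last exact: group_graded_HH j D n.
split=> [n|n|n X Y f x|].
(* The index shifts by one since [bar A n] has n+2 factors and [gpow A n] has n+1. *)
- exact: gpow_bimod A n.+1.
- exact: bar_d_hom.
- exact: bar_dK.
- exact: hochschild_complex_exists.
Qed.
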